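(* Let $\mathbf P\in\mathbb R^{3\times n}$ have columns linearly independent over $\mathbb Q$, let $\kappa>0$, let $\varepsilon$ be a real quasiperiodic function (with projection matrix $\mathbf P$) satisfying $0<\varepsilon_A\le\varepsilon\le\varepsilon_B<\infty$, let $\bm g$ be a quasiperiodic vector field in $L^2_{\rm qp}(\mathbb R^3)^3$ with $\nabla\cdot\bm g=0$, and let $N$ be a positive integer. Let $\bm u\in\bm V_{\rm qp}^{\rm div0}$ be the solution of $$(\varepsilon^{-1}\nabla\times\bm u,\nabla\times\bm v)_{\rm qp}+\kappa(\bm u,\bm v)_{\rm qp}=(\bm g,\bm v)_{\rm qp}\quad\forall\,\bm v\in\bm V_{\rm qp}^{\rm div0}$$ (the weak form of $\nabla\times(\varepsilon^{-1}\nabla\times\bm u)+\kappa\bm u=\bm g$ in $\mathbb R^3$), and let $\bm u^N\in\bm V_{N,{\rm qp}}^{\rm div0}$ be the solution of $$(\varepsilon^{-1}\nabla\times\bm u^N,\nabla\times\bm v^N)_{\rm qp}+\kappa(\bm u^N,\bm v^N)_{\rm qp}=(\bm g,\bm v^N)_{\rm qp}\quad\forall\,\bm v^N\in\bm V_{N,{\rm qp}}^{\rm div0}.$$ Put $\bm w=\nabla\times\bm u$. If $\mathcal P[\bm u],\mathcal P[\bm w]\in H^m_{\rm per}(\mathbb T^n)^3$ with $m\in\mathbb Z^+$, then $$\|\bm u-\bm u^N\|_{\rm qp,curl}\le C N^{-m}\big(|\mathcal P[\bm u]|_{m,{\rm per}}+|\mathcal P[\bm w]|_{m,{\rm per}}\big),$$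 where the positive constant $C$ depends only on $\kappa,\varepsilon_A$ and $\varepsilon_B$.
   Context: A function $f$ on $\mathbb R^3$ is quasiperiodic with projection matrix $\mathbf P$ if $f(\bm z)=F(\mathbf P^{\intercal}\bm z)$ with $F=\mathcal P[f]$ (the parent function) $2\pi$-periodic in each of $n$ variables; $\mathbb T^n=[0,2\pi]^n$. With $m(f)=\lim_{L\to\infty}(2L)^{-3}\int_{[-L,L]^3}f\,d\bm z$, set $(f,g)_{\rm qp}=m(f\bar g)$, $\|f\|_{\rm qp}^2=(f,f)_{\rm qp}$ (for vector fields, with the Euclidean inner product). $L^2_{\rm qp}(\mathbb R^3)$ is the space of quasiperiodic functions with respect to $\mathbf P$ with finite $\|\cdot\|_{\rm qp}$. Let $\mathbb Z[{\rm col}(\mathbf P)]=\{\mathbf P\bm k:\bm k\in\mathbb Z^n\}$. Each $f\in L^2_{\rm qp}$ has a generalized Fourier series $f=\sum_{\bm q\in\mathbb Z[{\rm col}(\mathbf P)]}\hat f_{\bm q}e^{{\rm i}\langle\bm q,\bm z\rangle}$, $\hat f_{\bm q}=(f,e^{{\rm i}\langle\bm q,\bm z\rangle})_{\rm qp}$, with Parseval identity $\|f\|_{\rm qp}^2=\sum|\hat f_{\bm q}|^2$; the Fourier coefficients of its parent function $F$ are $\hat F_{\bm k}=\hat f_{\mathbf P\bm k}$, $\bm k\in\mathbb Z^n$. Derivatives correspond to termwise differentiation of the series. For periodic $F$ on $\mathbb T^n$, $|F|_{m,{\rm per}}^2=\sum_{\bm k\in\mathbb Z^n}|\bm k|^{2m}|\hat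 F_{\bm k}|^2$, and $H^m_{\rm per}(\mathbb T^n)$ is the usual periodic Sobolev space. $H_{\rm qp}({\rm curl},\mathbb R^3)=\{\bm u\in L^2_{\rm qp}(\mathbb R^3)^3:\nabla\times\bm u\in L^2_{\rm qp}(\mathbb R^3)^3\}$ with norm $\|\bm u\|_{\rm qp,curl}^2=\|\bm u\|_{\rm qp}^2+\|\nabla\times\bm u\|_{\rm qp}^2$. $\bm V_{\rm qp}^{\rm div0}=\{\bm u\in H_{\rm qp}({\rm curl},\mathbb R^3):\nabla\cdot\bm u=0\}$. $\bm V_{N,{\rm qp}}^{\rm div0}$ is the set of divergence-free fields in the complex span of $\{e^{{\rm i}\langle\bm q,\bm z\rangle}\bm e_j: j=1,2,3,\ \bm q=\mathbf P\bm k,\ \bm k\in\mathbb Z^n,\ \|\bm k\|_\infty\le N\}$. *)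

(* Defs.v *)
From HB Require Import structures.
From mathcomp Require Import all_boot all_order all_algebra.
From mathcomp Require Import all_classical all_reals all_analysis.
From mathcomp Require Import complex.

Set Implicit Arguments.
Unset Strict Implicit.
Unset Printing Implicit Defensive.

Import Order.TTheory GRing.Theory Num.Theory.
Import numFieldNormedType.Exports.

Local Open Scope classical_set_scope.
Local Open Scope complex_scope.
Local Open Scope ring_scope.

(** Points of R^n are [n.-tuple R], whose sigma-algebra is the product one;
    [lebesgue_tuple n] is Lebesgue measure there, obtained from lambda^1 (x)
    lambda^n transported along (x, t) |-> x :: t. *)
Section lebesgue_tuple.
Variable R : realType.

Definition tcons n (xt : measurableTypeR R * n.-tuple R) : n.+1.-tuple R :=
  [the n.+1.-tuple R of xt.1 :: xt.2].

Lemma measurable_tcons n : measurable_fun setT (@tcons n).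
Proof. exact: measurable_cons. Qed.

Section lebesgue_step.
Variables (n : nat) (mu : {sigma_finite_measure set (n.-tuple R) -> \bar R}).

Definition lebesgue_step : set (n.+1.-tuple R) -> \bar R :=
  pushforward (@lebesgue_measure R \x mu)%E (@tcons n).

Let mpre (A : set (n.+1.-tuple R)) :
  measurable A -> measurable (@tcons n @^-1` A).
Proof. by move=> mA; rewrite -[X in measurable X]setTI; exact: measurable_tcons. Qed.

Let step0 : lebesgue_step set0 = 0%E.
Proof. by rewrite /lebesgue_step /pushforward preimage_set0 measure0. Qed.

Let step_ge0 A : (0 <= lebesgue_step A)%E.
Proof. by rewrite /lebesgue_step /pushforward; apply: measure_ge0. Qed.

Let step_sigma_additive : semi_sigma_additive lebesgue_step.
Proof.
move=> F mF tF mUF; rewrite /lebesgue_step /pushforward preimage_bigcup.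
apply: measure_semi_sigma_additive.
- by move=> k; exact: mpre.
- apply/trivIsetP => /= i j _ _ ij; rewrite -preimage_setI.
  by move/trivIsetP : tF => /(_ _ _ _ _ ij) ->//; rewrite preimage_set0.
- by rewrite -preimage_bigcup; exact: mpre.
Qed.

HB.instance Definition _ := isMeasure.Build _ _ _
  lebesgue_step step0 step_ge0 step_sigma_additive.

Let step_sigma_finite : sigma_finite setT lebesgue_step.
Proof.
have /sigma_finiteP[F [TF ndF Foo]] := sigma_finiteT (@lebesgue_measure R).
have /sigma_finiteP[G [TG ndG Goo]] := sigma_finiteT mu.
pose tcut (y : n.+1.-tuple R) : measurableTypeR R * n.-tuple R :=
  (thead y, [tuple of behead y]).
have tconsK : cancel (@tcons n) tcut by move=> [x t]; congr (_, _); exact/val_inj.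
have mcut : measurable_fun setT tcut.
  apply/measurable_fun_pairP; split.
    exact: (measurable_tnth (T := R) ord0).
  exact: (measurable_behead (T := R)).
exists (fun i => tcut @^-1` (F i `*` G i)).
  rewrite -preimage_bigcup; apply/esym; rewrite -[RHS](preimage_setT tcut).
  congr (_ @^-1` _); rewrite -setXTT TF TG predeqE => -[x y]; split.
    by move=> [k _ [/= Fx Gy]]; split; exists k.
  move=> [/= [i _ Fx] [j _ Gy]]; exists (maxn i j) => //; split => /=.
    by move: x Fx; exact/subsetPset/ndF/leq_maxl.
  by move: y Gy; exact/subsetPset/ndG/leq_maxr.
move=> i; have [mFi Fioo] := Foo i; have [mGi Gioo] := Goo i; split.
  by rewrite -[X in measurable X]setTI; apply: mcut => //; exact: measurableX.
rewrite /lebesgue_step /pushforward.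
suff -> : @tcons n @^-1` (tcut @^-1` (F i `*` G i)) = F i `*` G i.
  rewrite product_measure1E// lte_mul_pinfty//.
  by rewrite ge0_fin_numE.
by rewrite -comp_preimage (_ : tcut \o _ = id) ?preimage_id//; exact/funext.
Qed.

HB.instance Definition _ := Measure_isSigmaFinite.Build _ _ _
  lebesgue_step step_sigma_finite.

End lebesgue_step.

Fixpoint lebesgue_tuple n : {sigma_finite_measure set (n.-tuple R) -> \bar R} :=
  match n with
  | 0%N => \d_([tuple] : 0.-tuple R)
  | n'.+1 => lebesgue_step (lebesgue_tuple n')
  end.

End lebesgue_tuple.

Section quasiperiodic.
Variable R : realType.
Local Notation C := R[i].

Definition cexp (t : R) : C := cos t +i* sin t.

Definition sqmod (a : C) : R := complex.Re a ^+ 2 + complex.Im a ^+ 2.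

Definition cube n (a b : R) : set (n.-tuple R) :=
  [set x | forall i : 'I_n, a <= tnth x i <= b].

Definition cmeasurable n (f : n.-tuple R -> C) : Prop :=
  measurable_fun setT (@complex.Re R \o f) /\ measurable_fun setT (@complex.Im R \o f).

(* e^{i<q, x>} *)
Definition expi n (q : 'cV[R]_n) (x : n.-tuple R) : C :=
  cexp (\sum_j q j 0 * tnth x j).

Definition avg (L : R) (f : 3.-tuple R -> R) : R :=
  (2 * L) ^- 3 * \int[lebesgue_tuple R 3]_(z in cube (- L) L) f z.

(* m(f); real and imaginary parts are averaged separately *)
Definition mean (f : 3.-tuple R -> C) : C :=
  lim (avg L (@complex.Re R \o f) @[L --> +oo%R])
  +i* lim (avg L (@complex.Im R \o f) @[L --> +oo%R]).

Definition qp_ip (f g : 3.-tuple R -> C) : C :=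
  mean (fun z => f z * conjc (g z)).

Definition qp_ipv (u v : 3.-tuple R -> 'cV[C]_3) : C :=
  mean (fun z => \sum_j u z j 0 * conjc (v z j 0)).

Definition qp_normv (u : 3.-tuple R -> 'cV[C]_3) : R :=
  Num.sqrt (complex.Re (qp_ipv u u)).

Definition component (u : 3.-tuple R -> 'cV[C]_3) (j : 'I_3) (z : 3.-tuple R) : C :=
  u z j 0.

Definition periodic2pi n (F : n.-tuple R -> C) : Prop :=
  forall (y : n.-tuple R) (j : 'I_n),
    F [tuple tnth y i + (if i == j then 2 * pi else 0) | i < n] = F y.

Definition ivec n (k : 'cV[int]_n) : 'cV[R]_n := map_mx intr k.

Definition per_coef n (F : n.-tuple R -> C) (k : 'cV[int]_n) : C :=
  let G y := F y * conjc (expi (ivec k) y) in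
  ((2 * pi) ^- n)%:C *
  ((\int[lebesgue_tuple R n]_(y in cube 0 (2 * pi)) complex.Re (G y))
   +i* (\int[lebesgue_tuple R n]_(y in cube 0 (2 * pi)) complex.Im (G y))).

(* |k|^2, with the Euclidean norm *)
Definition sqnormz n (k : 'cV[int]_n) : R := \sum_j (k j 0)%:~R ^+ 2.

Definition Hper n (m : nat) (F : n.-tuple R -> C) : Prop :=
  [/\ periodic2pi F,
      cmeasurable F,
      (\int[lebesgue_tuple R n]_(y in cube 0 (2 * pi)) (sqmod (F y))%:E
        < +oo)%E &
      (\esum_(k in [set: 'cV[int]_n])
        ((1 + sqnormz k) ^+ m * sqmod (per_coef F k))%:E < +oo)%E].

Definition per_sqseminorm n (m : nat) (F : n.-tuple R -> C) : R :=
  fine (\esum_(k in [set: 'cV[int]_n])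
          (sqnormz k ^+ m * sqmod (per_coef F k))%:E).

Definition per_seminormv n (m : nat) (F : 'I_3 -> n.-tuple R -> C) : R :=
  Num.sqrt (\sum_j per_sqseminorm m (F j)).

Definition tpoly n (s : seq 'cV[int]_n) (c : 'cV[int]_n -> C)
    (y : n.-tuple R) : C :=
  \sum_(k <- s) c k * expi (ivec k) y.

Section projection.
Variables (n : nat) (P : 'M[R]_(3, n)).

Definition Qindep : Prop :=
  forall k : 'cV[rat]_n, P *m map_mx ratr k = 0 -> k = 0.

(* z |-> P^T z *)
Definition projT (z : 3.-tuple R) : n.-tuple R :=
  [tuple \sum_j P j k * tnth z j | k < n].

Definition freq (k : 'cV[int]_n) : 'cV[R]_3 := P *m ivec k.

(** For n > 3 the image of [projT] is usually Lebesgue-null modulo 2 pi, so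
    [f = F \o projT] alone ties neither the mean values of [f] nor its
    coefficients to an F in L^2(T^n).  The relation is therefore understood in
    mean square: trigonometric polynomials approximate F in L^2(T^n) while
    their restrictions approximate f in the seminorm of L^2_qp (Besicovitch).
    Square integrability of F on the torus and local square integrability
    of f follow. *)
Definition is_parent (f : 3.-tuple R -> C) (F : n.-tuple R -> C) : Prop :=
  [/\ periodic2pi F,
      cmeasurable F,
      cmeasurable f,
      (forall z, f z = F (projT z)) &
      forall e : R, 0 < e ->
        exists (s : seq 'cV[int]_n) (c : 'cV[int]_n -> C),
        (\int[lebesgue_tuple R n]_(y in cube 0 (2 * pi))
            (sqmod (F y - tpoly s c y))%:E <= e%:E)%E /\
        \forall L \near +oo,
          (\int[lebesgue_tuple R 3]_(z in cube (- L) L)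
             (sqmod (f z - tpoly s c (projT z)))%:E
           <= (e * (2 * L) ^+ 3)%:E)%E].

Definition L2qp (f : 3.-tuple R -> C) : Prop := exists F, is_parent f F.

(* on L^2_qp any two choices have the same Fourier coefficients when the columns
   of P are independent over Q *)
Definition parent (f : 3.-tuple R -> C) : n.-tuple R -> C :=
  xget (fun=> 0) [set F | is_parent f F].

Definition parentv (u : 3.-tuple R -> 'cV[C]_3) (j : 'I_3) : n.-tuple R -> C :=
  parent (component u j).

Definition L2qpv (u : 3.-tuple R -> 'cV[C]_3) : Prop :=
  forall j, L2qp (component u j).

Definition qp_coef (f : 3.-tuple R -> C) (q : 'cV[R]_3) : C :=
  qp_ip f (expi q).

Definition qp_coefv (u : 3.-tuple R -> 'cV[C]_3) (q : 'cV[R]_3) : 'cV[C]_3 :=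
  \col_j qp_coef (component u j) q.

(* indices are added modulo 3 *)
Definition cross (a b : 'cV[C]_3) : 'cV[C]_3 :=
  \col_(i < 3) (a (i + 1) 0 * b (i + 2) 0 - a (i + 2) 0 * b (i + 1) 0).

(** Differential operators act term by term on the generalized Fourier series;
    elements of L^2_qp are functions up to a null function for the seminorm,
    so a curl is determined by its coefficients only up to such a function. *)
Definition is_curl (u w : 3.-tuple R -> 'cV[C]_3) : Prop :=
  L2qpv w /\
  forall k : 'cV[int]_n,
    qp_coefv w (freq k) =
    'i *: cross (map_mx (real_complex R) (freq k)) (qp_coefv u (freq k)).

Definition curl (u : 3.-tuple R -> 'cV[C]_3) : 3.-tuple R -> 'cV[C]_3 :=
  xget (fun=> 0) [set w | is_curl u w].

(* i <q, u^_q> = 0 for every q in Z[col(P)] *)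
Definition div_free (u : 3.-tuple R -> 'cV[C]_3) : Prop :=
  forall k : 'cV[int]_n,
    'i * \sum_j (freq k j 0)%:C * qp_coef (component u j) (freq k) = 0.

Definition Hcurl (u : 3.-tuple R -> 'cV[C]_3) : Prop :=
  L2qpv u /\ exists w, is_curl u w.

Definition qp_curl_norm (u : 3.-tuple R -> 'cV[C]_3) : R :=
  Num.sqrt (qp_normv u ^+ 2 + qp_normv (curl u) ^+ 2).

Definition Vdiv0 (u : 3.-tuple R -> 'cV[C]_3) : Prop := Hcurl u /\ div_free u.

(* the span is complex; exponents k range over the box |k|_oo <= N *)
Definition VNdiv0 (N : nat) (u : 3.-tuple R -> 'cV[C]_3) : Prop :=
  (exists (s : seq 'cV[int]_n) (c : 'cV[int]_n -> 'cV[C]_3),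
     (forall k, k \in s -> forall j, `|k j 0| <= N%:Z) /\
     u = fun z => \sum_(k <- s) expi (freq k) z *: c k) /\
  div_free u.

Definition weak_solution (eps : 3.-tuple R -> R) (kappa : R)
    (g : 3.-tuple R -> 'cV[C]_3) (V : set (3.-tuple R -> 'cV[C]_3))
    (u : 3.-tuple R -> 'cV[C]_3) : Prop :=
  V u /\
  forall v, V v ->
    qp_ipv (fun z => ((eps z)^-1)%:C *: curl u z) (curl v)
    + kappa%:C * qp_ipv u v = qp_ipv g v.

End projection.
End quasiperiodic.

(* Main.v *)
(** Céa's lemma on the divergence-free trigonometric fields, followed by
    Parseval.  Functions of L^2_qp lie in the Besicovitch class: they are limits,
    in the mean-square seminorm, of trigonometric polynomials with frequencies
    P k.  On that class all the means exist, Bessel's inequality holds, and the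
    squared seminorm is at most the supremum of the finite sums of squared
    coefficients; rational independence of the columns of P makes the
    frequencies P k distinct, so these coefficients are those of the parent
    function on the torus.  The class is stable under multiplication by
    1/epsilon, which gives a meaning to the energy form.  If v is the truncation
    of u - u^N to the box |k|_oo <= N, then v is an admissible discrete test
    field, and Galerkin orthogonality bounds the curl norm of u - u^N by that of
    u - u^N - v, whose coefficients vanish in the box and are those of u outside
    it, where |k| >= N. *)
Require Import Defs.
From mathcomp Require Import all_boot all_order all_algebra.
From mathcomp Require Import all_classical all_reals all_analysis.
From mathcomp Require Import measurable_realfun.
From mathcomp Require Import complex.
From mathcomp Require Import ring lra zify.
Import Order.TTheory GRing.Theory Num.Theory.
Import numFieldNormedType.Exports.
Local Open Scope classical_set_scope.
Local Open Scope complex_scope.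
Local Open Scope ring_scope.
Set Implicit Arguments.
Unset Strict Implicit.

(** * Integrals of cosines over cubes *)

(** [mean] is a [lim] and [curl] an [xget]: both are total, and their values say nothing when no
    limit or no curl exists. Every computation therefore goes through a predicate that carries
    existence ([has_rmean], [has_mean], [is_curl]), and linearity is applied only to means already
    known to converge. Convergence rests on one explicit integral, that of a cosine with a phase
    over a cube, and on completeness. The energy estimate is proved as an inequality between
    integrands at each point z and then averaged, so that no Cauchy-Schwarz inequality for means is
    required. Truncating the error instead of u loses nothing: u^N is its own truncation, hence u -
    u^N - v has the coefficients of u minus the truncation of u. The constant is c1 / c0, where c0 =
    min(kappa, 1/epsB) and c1 = max(kappa, 1/epsA) enclose both weights kappa and 1/epsilon of the
    form. *)

Lemma integrable_EFinZ d (T : measurableType d) (R : realType)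
    (mu : {measure set T -> \bar R}) (D : set T) (k : R) (g : T -> R) :
  measurable D -> mu.-integrable D (EFin \o g) ->
  mu.-integrable D (EFin \o (fun x => k * g x)).
Proof.
move=> mD ig; rewrite (_ : _ \o _ = fun x => (k%:E * (g x)%:E)%E)//.
exact: integrableZl.
Qed.

Section cube_integral.
Context {R : realType}.
Implicit Types (a b c : R).

Lemma measurable_cube n a b : measurable (@cube R n a b).
Proof.
rewrite (_ : cube a b =
    \bigcap_(i in [set: 'I_n]) ((@tnth n R ^~ i) @^-1` `[a, b])).
  apply: fin_bigcap_measurable => [|i _]; first exact: finite_finset.
  by rewrite -[X in measurable X]setTI; exact: (measurable_tnth (T := R)).
apply/seteqP; split=> [x h i _ | x h i].
  by rewrite /= in_itv; exact: h.
by have := h i I; rewrite /= in_itv.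
Qed.

Lemma preimage_tcons_cube n a b :
  @tcons R n @^-1` cube a b = `[a, b]%classic `*` cube a b.
Proof.
apply/seteqP; split=> [[x t] /= h | [x t] /= [hx h] i].
  split; first by rewrite in_itv; have := h ord0; rewrite tnth0.
  by move=> i; have := h (lift ord0 i); rewrite tnthS.
case: (unliftP ord0 i) => [j ->|->]; first by rewrite tnthS.
by move: hx; rewrite tnth0 in_itv.
Qed.

Lemma lebesgue_measure_itvcc a b : a <= b ->
  @lebesgue_measure R `[a, b]%classic = (b - a)%:E.
Proof.
move=> ab; rewrite [LHS](lebesgue_measure_itv `[a, b])/= lte_fin.
by case: ltP => // ba; rewrite (_ : b = a) ?subrr//; apply/le_anti/andP.
Qed.

Lemma cube_measureE n a b : a <= b ->
  lebesgue_tuple R n (cube a b) = ((b - a) ^+ n)%:E.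
Proof.
move=> ab; elim: n => [|n IHn] /=.
  by rewrite expr0 diracE mem_set// => -[].
rewrite /lebesgue_step /pushforward preimage_tcons_cube.
rewrite product_measure1E//; last exact: measurable_cube.
rewrite [X in (_ * X)%E](_ : _ = ((b - a) ^+ n)%:E)//.
by rewrite [X in (X * _)%E](lebesgue_measure_itvcc ab) exprS.
Qed.

Lemma bounded_cube_integrable n a b (h : n.-tuple R -> R) (M : R) : a <= b ->
  measurable_fun setT h -> (forall y, `|h y| <= M) ->
  (lebesgue_tuple R n).-integrable (cube a b) (EFin \o h).
Proof.
move=> ab mh hM; apply: measurable_bounded_integrable.
- exact: measurable_cube.
- by rewrite [X in (X < _)%E]cube_measureE// ltry.
- exact: measurable_funTS.
- exists M; split; first exact: num_real.
  by move=> x Mx y _ /=; exact: le_trans (hM y) (ltW Mx).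
Qed.

Lemma cube_fubini n a b (h : n.+1.-tuple R -> R) (M : R) : a <= b ->
  measurable_fun setT h -> (forall y, `|h y| <= M) ->
  \int[lebesgue_tuple R n.+1]_(y in cube a b) h y =
  \int[@lebesgue_measure R]_(x in `[a, b])
    \int[lebesgue_tuple R n]_(t in cube a b) h (tcons (x, t)).
Proof.
move=> ab mh hM.
have mD := @measurable_cube n.+1 a b.
pose D' : set (measurableTypeR R * n.-tuple R) := `[a, b]%classic `*` cube a b.
have mD' : measurable D' by apply: measurableX => //; exact: measurable_cube.
have mht : measurable_fun setT (h \o @tcons R n).
  by apply: measurableT_comp => //; exact: measurable_tcons.
have iD' : (@lebesgue_measure R \x lebesgue_tuple R n)%E.-integrable D'
    (EFin \o (h \o @tcons R n)).
  apply: measurable_bounded_integrable => //.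
  - rewrite [X in (X < _)%E](_ : _ = ((b - a) ^+ n.+1)%:E) ?ltry//.
    by rewrite -(@cube_measureE n.+1 _ _ ab)/= /lebesgue_step/pushforward preimage_tcons_cube.
  - exact: measurable_funTS.
  - exists M; split; first exact: num_real.
    by move=> x Mx y _ /=; exact: le_trans (hM _) (ltW Mx).
have -> : \int[lebesgue_tuple R n.+1]_(y in cube a b) h y =
    \int[(@lebesgue_measure R \x lebesgue_tuple R n)%E]_(y in D') h (tcons y).
  rewrite /Rintegral; congr fine.
  rewrite -[D']preimage_tcons_cube.
  rewrite -(@integral_pushforward _ _ _ _ R (@tcons R n) (@measurable_tcons R n)
    _ (cube a b) (EFin \o h)) //; first by exact/measurable_EFinP.
  by rewrite preimage_tcons_cube.
(* Fubini is applied on the whole product space, to the function extended by zero outside the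
   box. *)
rewrite {1}/Rintegral integral_mkcond.
rewrite -integral12_prod_meas1; last first.
  by apply/(integrable_mkcond _ mD').
rewrite /Rintegral [in RHS]integral_mkcond; congr fine.
apply: eq_integral => x _ /=; rewrite /patch/=.
case: ifPn => xab.
  rewrite fineK; last first.
    apply: integrable_fin_num; first exact: measurable_cube.
    apply: (@bounded_cube_integrable n a b (h \o (@tcons R n \o pair x)) M) => //.
    by apply: (measurableT_comp mht); exact: measurable_pair1.
    by move=> y; exact: hM.
  rewrite /fubini_F [RHS]integral_mkcond; apply: eq_integral => t _ /=.
  rewrite /patch /D'; congr (if _ then _ else _).
  by rewrite in_setX xab.
rewrite /fubini_F integral0_eq// => t _.
by rewrite in_setX (negbTE xab).
Qed.

(* The integral of [cos (q x)] over an interval of length [w] centred at 0. *)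
Definition osc (w q : R) : R := if q == 0 then w else 2 * sin (q * w / 2) / q.

(** Writing the result with the phase at the midpoint keeps it a cosine of an affine function, ready
    for the next variable. *)
Lemma integral_cos_itv (th q a b : R) : a < b ->
  \int[@lebesgue_measure R]_(x in `[a, b]) cos (th + q * x) =
  osc (b - a) q * cos (th + q * ((a + b) / 2)).
Proof.
move=> ab; rewrite /osc; have [->|q0] := eqVneq q 0.
  under eq_Rintegral do rewrite mul0r addr0.
  rewrite Rintegral_cst// [X in fine X](lebesgue_measure_itvcc (ltW ab))/=.
  by rewrite mul0r addr0 mulrC.
have dF (x : R) : is_derive x (1 : R) (fun x => sin (th + q * x) / q) (cos (th + q * x)).
  apply: is_derive_eq.
  rewrite /GRing.scale/= !(mulr0, add0r, mulr1, scaler0, addr0).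
  by field.
pose F x := sin (th + q * x) / q.
have cF x : {for x, continuous F}.
  by apply: differentiable_continuous; apply/derivable1_diffP; case: (dF x).
rewrite /Rintegral (@continuous_FTC2 _ _ F)//=.
- rewrite /F.
  have -> : th + q * b = (th + q * ((a + b) / 2)) + q * (b - a) / 2 by field.
  have -> : th + q * a = (th + q * ((a + b) / 2)) - q * (b - a) / 2 by field.
  by rewrite sinD sinB; field.
- apply: continuous_subspaceT => x.
  apply: continuous_comp; last exact: continuous_cos.
  apply: continuousD; first exact: cst_continuous.
  by apply: continuousM; [exact: cst_continuous | exact: id].
- split.
  + by move=> x _; case: (dF x).
  + by apply: cvg_at_right_filter; exact: cF.
  + by apply: cvg_at_left_filter; exact: cF.
- by move=> x _; rewrite derive1E; case: (dF x).
Qed.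

Lemma measurable_dot n (q : 'I_n -> R) :
  measurable_fun setT (fun y : n.-tuple R => \sum_j q j * tnth y j).
Proof.
apply: measurable_sum => j; apply: measurable_funM => //.
exact: measurable_tnth.
Qed.

Lemma measurable_cos_dot n (th : R) (q : 'I_n -> R) :
  measurable_fun setT (fun y : n.-tuple R => cos (th + \sum_j q j * tnth y j)).
Proof.
apply: (@measurableT_comp _ _ _ _ _ _ (@cos R)).
  exact: continuous_measurable_fun (@continuous_cos R).
by apply: measurable_funD => //; exact: measurable_dot.
Qed.

(** Integrating out one variable leaves a cosine of the others with a shifted phase. The free phase
    [th] makes the induction go through, and later turns cosines into sines. *)
Lemma integral_cos_cube n (th : R) (q : 'I_n -> R) a b : a < b ->
  \int[lebesgue_tuple R n]_(y in cube a b) cos (th + \sum_j q j * tnth y j) =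
  (\prod_j osc (b - a) (q j)) * cos (th + \sum_j q j * ((a + b) / 2)).
Proof.
move=> ab; elim: n q th => [|n IHn] q th.
  rewrite !big_ord0 addr0 mul1r.
  rewrite [LHS](@eq_Rintegral _ _ _ _ _ (cst (cos th))); last first.
    by move=> y _; rewrite big_ord0 addr0.
  rewrite Rintegral_cst; last exact: measurable_cube.
  by rewrite [X in fine X](@cube_measureE 0 _ _ (ltW ab)) /= expr0 mulr1.
rewrite (@cube_fubini _ _ _ _ 1) ?(ltW ab)//; last first.
- by move=> y; rewrite ler_norml cos_geN1 cos_le1.
- exact: measurable_cos_dot.
set th' := th + \sum_j q (lift ord0 j) * ((a + b) / 2).
have step (x : R) : \int[lebesgue_tuple R n]_(t in cube a b)
      cos (th + \sum_j q j * tnth (tcons (x, t)) j) =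
    \prod_j osc (b - a) (q (lift ord0 j)) * cos (th' + q ord0 * x).
  rewrite /th' addrAC -IHn; apply: eq_Rintegral => t _ /=.
  rewrite big_ord_recl /= tnth0 addrA; congr (cos (_ + _)).
  by apply: eq_bigr => j _; rewrite tnthS.
under eq_Rintegral do rewrite step.
rewrite RintegralZl//; last first.
  apply: measurable_bounded_integrable => //.
  - by rewrite [X in (X < _)%E](lebesgue_measure_itvcc (ltW ab)) ltry.
  - apply: measurable_funTS; apply: (@measurableT_comp _ _ _ _ _ _ (@cos R)).
      exact: continuous_measurable_fun (@continuous_cos R).
    by apply: measurable_funD => //; exact: measurable_funM.
  - exists 1; split; first exact: num_real.
    by move=> x Mx y _ /=; apply/ltW/le_lt_trans/Mx; rewrite ler_norml cos_geN1 cos_le1.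
rewrite integral_cos_itv// big_ord_recl mulrCA mulrA.
by rewrite big_ord_recl addrAC addrA addrAC -!addrA.
Qed.

End cube_integral.

(** * Mean values of real functions *)

Section real_mean.
Context {R : realType}.
Local Notation E := (3.-tuple R).
Implicit Types (h : E -> R) (l L : R).

Definition locint h := forall L, 0 < L ->
  (lebesgue_tuple R 3).-integrable (cube (- L) L) (EFin \o h).

(** Local integrability is included because [Rintegral] is additive only on integrable functions;
    with it the notion is stable under linear combinations. *)
Definition has_rmean h l := locint h /\ avg L h @[L --> +oo%R] --> l.

Lemma near_pinfty_gt0 (Q : R -> Prop) :
  (forall L, 0 < L -> Q L) -> \forall L \near +oo%R, Q L.
Proof.
by move=> h; near=> L; apply: h; near: L; apply: nbhs_pinfty_gt.
Unshelve. all: by end_near. Qed.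

Lemma bounded_locint h (M : R) : measurable_fun setT h ->
  (forall z, `|h z| <= M) -> locint h.
Proof.
move=> mh hM L L0; apply: (bounded_cube_integrable _ mh hM).
by rewrite lerNl (le_trans _ (ltW L0))// oppr_le0 ltW.
Qed.

Lemma locintZ k h : locint h -> locint (fun z => k * h z).
Proof.
by move=> ih L L0; apply: integrable_EFinZ (ih _ L0); exact: measurable_cube.
Qed.

Lemma locintD h1 h2 : locint h1 -> locint h2 -> locint (fun z => h1 z + h2 z).
Proof.
move=> i1 i2 L L0.
rewrite (_ : _ \o _ = (EFin \o h1) \+ (EFin \o h2))//.
by apply: integrableD => //; [exact: measurable_cube | exact: i1 | exact: i2].
Qed.

Lemma locintN h : locint h -> locint (fun z => - h z).
Proof.
by move=> ih; under eq_fun do rewrite -mulN1r; exact: locintZ.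
Qed.

Lemma locint_le h1 h2 : measurable_fun setT h1 ->
  (forall z, `|h1 z| <= h2 z) -> locint h2 -> locint h1.
Proof.
move=> m1 h12 i2 L L0; apply: le_integrable (i2 _ L0).
- exact: measurable_cube.
- by apply/measurable_EFinP; exact: measurable_funTS.
- move=> z _; rewrite /= lee_fin; apply: (le_trans (h12 z)).
  exact: ler_norm.
Qed.

Lemma avgZ k h L : 0 < L -> locint h -> avg L (fun z => k * h z) = k * avg L h.
Proof.
move=> L0 ih; rewrite /avg RintegralZl; last exact: ih.
  by rewrite mulrCA.
exact: measurable_cube.
Qed.

Lemma avgD h1 h2 L : 0 < L -> locint h1 -> locint h2 ->
  avg L (fun z => h1 z + h2 z) = avg L h1 + avg L h2.
Proof.
move=> L0 i1 i2; rewrite /avg RintegralD ?mulrDr//; last 2 first.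
- exact: i1.
- exact: i2.
exact: measurable_cube.
Qed.

Lemma le_avg h1 h2 L : 0 < L -> locint h1 -> locint h2 ->
  (forall z, h1 z <= h2 z) -> avg L h1 <= avg L h2.
Proof.
move=> L0 i1 i2 h12; rewrite /avg ler_pM2l; last first.
  by rewrite invr_gt0 exprn_gt0// mulr_gt0.
by apply: le_Rintegral => //; [exact: measurable_cube | exact: i1 | exact: i2].
Qed.

Lemma has_rmean_lim h l : has_rmean h l -> lim (avg L h @[L --> +oo%R]) = l.
Proof. by case=> _ c; apply/cvg_lim. Qed.

Lemma has_rmean_unique h l1 l2 : has_rmean h l1 -> has_rmean h l2 -> l1 = l2.
Proof. by move=> /has_rmean_lim <- /has_rmean_lim <-. Qed.

Lemma has_rmeanD h1 h2 l1 l2 : has_rmean h1 l1 -> has_rmean h2 l2 ->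
  has_rmean (fun z => h1 z + h2 z) (l1 + l2).
Proof.
move=> [i1 c1] [i2 c2]; split; first exact: locintD.
apply: cvg_trans (cvgD c1 c2); apply: near_eq_cvg.
by apply: near_pinfty_gt0 => L L0; rewrite /= avgD.
Qed.

Lemma has_rmeanZ k h l : has_rmean h l -> has_rmean (fun z => k * h z) (k * l).
Proof.
move=> [i1 c1]; split; first exact: locintZ.
apply: cvg_trans (cvgM (@cvg_cst _ k _ _ _) c1); apply: near_eq_cvg.
by apply: near_pinfty_gt0 => L L0; rewrite /= avgZ.
Qed.

Lemma has_rmeanN h l : has_rmean h l -> has_rmean (fun z => - h z) (- l).
Proof.
by move=> /(has_rmeanZ (-1)); rewrite mulN1r; under eq_fun do rewrite mulN1r.
Qed.

Lemma has_rmeanB h1 h2 l1 l2 : has_rmean h1 l1 -> has_rmean h2 l2 ->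
  has_rmean (fun z => h1 z - h2 z) (l1 - l2).
Proof. by move=> m1 /has_rmeanN; exact: has_rmeanD. Qed.

Lemma has_rmean_le h1 h2 l1 l2 : has_rmean h1 l1 -> has_rmean h2 l2 ->
  (forall z, h1 z <= h2 z) -> l1 <= l2.
Proof.
move=> [i1 c1] [i2 c2] h12; apply: ler_cvg_to c1 c2 _.
by apply: near_pinfty_gt0 => L L0; exact: le_avg.
Qed.

Lemma has_rmean_le_near h l (e : R) : has_rmean h l ->
  (\forall L \near +oo%R, avg L h <= e) -> l <= e.
Proof. by move=> [_ c] /(cvgr_to_le c). Qed.

(** For q nonzero the quotient is sin(qL)/(qL), at most 1/(|q| L) in absolute value. *)
Lemma cvg_osc (q : R) :
  osc (2 * L) q / (2 * L) @[L --> +oo%R] --> ((q == 0)%:R : R).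
Proof.
rewrite /osc; have [_|q0] /= := eqVneq q 0.
  apply: cvg_near_cst; apply: near_pinfty_gt0 => L L0.
  by rewrite divff// mulf_neq0// gt_eqF.
apply/cvgrPdist_le => e e0; near=> L.
have L0 : 0 < L by near: L; apply: nbhs_pinfty_gt.
rewrite sub0r normrN.
have -> : 2 * sin (q * (2 * L) / 2) / q / (2 * L) =
    sin (q * (2 * L) / 2) / (q * L).
  by field; rewrite q0 gt_eqF.
rewrite normrM normfV ler_pdivrMr; last by rewrite normr_gt0 mulf_neq0// gt_eqF.
have sL : `|sin (q * (2 * L) / 2)| <= 1 by rewrite ler_norml sin_geN1 sin_le1.
apply: le_trans sL _.
rewrite normrM (gtr0_norm L0) mulrA -ler_pdivrMl ?mulr1; last first.
  by rewrite mulr_gt0// normr_gt0.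
by near: L; apply: nbhs_pinfty_ge; rewrite num_real.
Unshelve. all: by end_near. Qed.

Lemma has_rmean_cos (th : R) (q : 'I_3 -> R) :
  has_rmean (fun z : E => cos (th + \sum_j q j * tnth z j))
    ((\prod_j (q j == 0)%:R) * cos th).
Proof.
split.
  apply: (@bounded_locint _ 1); first exact: measurable_cos_dot.
  by move=> z; rewrite ler_norml cos_geN1 cos_le1.
have cprod : (\prod_j (osc (2 * L) (q j) / (2 * L))) * cos th @[L --> +oo%R] -->
    (\prod_j (q j == 0)%:R) * cos th.
  apply: cvgMl; rewrite !big_ord_recl big_ord0 mulr1.
  under eq_fun do rewrite !big_ord_recl big_ord0 mulr1.
  by apply: cvgM; [|apply: cvgM]; exact: cvg_osc.
apply: cvg_trans cprod; apply: near_eq_cvg.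
apply: near_pinfty_gt0 => L L0 /=.
rewrite /avg integral_cos_cube; last by rewrite -subr_gt0 opprK addr_gt0.
(* The cube is centred at 0, so the midpoint adds nothing to the phase. *)
rewrite (_ : th + _ = th); last first.
  by rewrite big1 ?addr0// => j _; rewrite addNr mul0r mulr0.
rewrite mulrA; congr (_ * _); have -> : L - - L = 2 * L by ring.
rewrite !big_ord_recl !big_ord0.
by field; rewrite gt_eqF.
Qed.

(** The averages of h form a Cauchy filter: those of h' eventually lie near l', and those of h near
    those of h'. Thirds of e keep the final inequality strict. *)
Lemma has_rmean_approx h : locint h ->
  (forall e : R, 0 < e -> exists h' l', has_rmean h' l' /\
     \forall L \near +oo%R, `|avg L h - avg L h'| <= e) ->
  exists l, has_rmean h l.
Proof.
move=> ih happ.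
suff /cauchy_cvg c : cauchy (avg L h @[L --> +oo%R]).
  by exists (lim (avg L h @[L --> +oo%R])); split.
apply: cauchy_exP => e e0.
have e2 : 0 < e / 3 by rewrite divr_gt0.
have [h' [l' [[_ c] hh']]] := happ _ e2.
exists l'; suff : \forall L \near +oo%R, `|l' - avg L h| < e by [].
near=> L.
have h1 : `|l' - avg L h'| <= e / 3.
  by near: L; move/cvgrPdist_le: c; exact.
have h2 : `|avg L h - avg L h'| <= e / 3 by near: L.
rewrite (_ : l' - _ = (l' - avg L h') - (avg L h - avg L h')); last by ring.
apply: le_lt_trans (ler_normB _ _) _.
by apply: le_lt_trans (lerD h1 h2) _; lra.
Unshelve. all: by end_near. Qed.

End real_mean.

(** * Complex functions and their means *)

Section complex_facts.
Context {R : realType}.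
Local Notation C := R[i].
Implicit Types x y : C.

Lemma Re_addc x y : complex.Re (x + y) = complex.Re x + complex.Re y.
Proof. by case: x; case: y. Qed.

Lemma Im_addc x y : complex.Im (x + y) = complex.Im x + complex.Im y.
Proof. by case: x; case: y. Qed.

Lemma Re_oppc x : complex.Re (- x) = - complex.Re x. Proof. by case: x. Qed.

Lemma Im_oppc x : complex.Im (- x) = - complex.Im x. Proof. by case: x. Qed.

Lemma Re_mulc x y :
  complex.Re (x * y) = complex.Re x * complex.Re y - complex.Im x * complex.Im y.
Proof. by case: x; case: y. Qed.

Lemma Im_mulc x y :
  complex.Im (x * y) = complex.Re x * complex.Im y + complex.Im x * complex.Re y.
Proof. by case: x; case: y. Qed.

Lemma Re_conjc x : complex.Re (conjc x) = complex.Re x. Proof. by case: x. Qed.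

Lemma Im_conjc x : complex.Im (conjc x) = - complex.Im x. Proof. by case: x. Qed.

Definition ReImE := (Re_addc, Im_addc, Re_oppc, Im_oppc, Re_mulc, Im_mulc, Re_conjc, Im_conjc).

Lemma Re_sum I (s : seq I) (F : I -> C) :
  complex.Re (\sum_(i <- s) F i) = \sum_(i <- s) complex.Re (F i).
Proof. exact: (big_morph _ Re_addc (erefl : complex.Re (0 : C) = 0)). Qed.

Lemma Im_sum I (s : seq I) (F : I -> C) :
  complex.Im (\sum_(i <- s) F i) = \sum_(i <- s) complex.Im (F i).
Proof. exact: (big_morph _ Im_addc (erefl : complex.Im (0 : C) = 0)). Qed.

Lemma complex_eqP x y :
  complex.Re x = complex.Re y -> complex.Im x = complex.Im y -> x = y.
Proof. by case: x; case: y => a b c d /= -> ->. Qed.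

Lemma sqmod_ge0 x : 0 <= sqmod x.
Proof. by rewrite addr_ge0 ?sqr_ge0. Qed.

Lemma sqmod_eq0 x : (sqmod x == 0) = (x == 0).
Proof. by rewrite /sqmod eq_complex paddr_eq0 ?sqr_ge0// !sqrf_eq0. Qed.

Lemma sqmodM x y : sqmod (x * y) = sqmod x * sqmod y.
Proof. by rewrite /sqmod !ReImE; ring. Qed.

Lemma sqmodN x : sqmod (- x) = sqmod x.
Proof. by rewrite /sqmod !ReImE !sqrrN. Qed.

Lemma sqmod_conj x : sqmod (conjc x) = sqmod x.
Proof. by rewrite /sqmod !ReImE sqrrN. Qed.

Lemma sqmodE x : sqmod x = complex.Re (x * conjc x).
Proof. by rewrite /sqmod !ReImE; ring. Qed.

Lemma sqmod0 : sqmod (0 : C) = 0.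
Proof. by rewrite /sqmod /= expr0n addr0. Qed.

Lemma sqmod_real (a : R) : sqmod a%:C = a ^+ 2.
Proof. by rewrite /sqmod /= expr0n addr0. Qed.

Lemma sqmodD_le x y : sqmod (x + y) <= 2 * sqmod x + 2 * sqmod y.
Proof.
rewrite /sqmod !ReImE -subr_ge0.
set a := complex.Re x; set b := complex.Im x; set c := complex.Re y.
set d := complex.Im y.
rewrite (_ : _ - _ = (a - c) ^+ 2 + (b - d) ^+ 2); last by ring.
by rewrite addr_ge0 ?sqr_ge0.
Qed.

(** Young's inequality applied to u^2 - v^2 = 2u(u - v) - (u - v)^2. The free weight d serves to
    compare mean squares when that of x is merely bounded and that of x - y is small. *)
Lemma sqmodB_le x y (d : R) : 0 < d ->
  `|sqmod x - sqmod y| <= d * sqmod x + (1 + d^-1) * sqmod (x - y).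
Proof.
move=> d0; rewrite /sqmod !ReImE.
set a := complex.Re x; set b := complex.Im x; set c := complex.Re y.
set e := complex.Im y.
have key (u v : R) : `|u ^+ 2 - v ^+ 2| <=
    d * u ^+ 2 + (1 + d^-1) * (u - v) ^+ 2.
  have P1 : 0 <= d^-1 * (d * u - (u - v)) ^+ 2.
    by rewrite mulr_ge0 ?sqr_ge0// invr_ge0 ltW.
  have P2 : 0 <= d^-1 * (d * u + (u - v)) ^+ 2.
    by rewrite mulr_ge0 ?sqr_ge0// invr_ge0 ltW.
  have E1 : d^-1 * (d * u - (u - v)) ^+ 2 =
      d * u ^+ 2 - 2 * u * (u - v) + d^-1 * (u - v) ^+ 2.
    by field; rewrite gt_eqF.
  have E2 : d^-1 * (d * u + (u - v)) ^+ 2 =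
      d * u ^+ 2 + 2 * u * (u - v) + d^-1 * (u - v) ^+ 2.
    by field; rewrite gt_eqF.
  have P3 := sqr_ge0 (u - v).
  by rewrite ler_norml mulrDl mul1r; nra.
rewrite (_ : _ - _ = (a ^+ 2 - c ^+ 2) + (b ^+ 2 - e ^+ 2)); last by ring.
apply: le_trans (ler_normD _ _) _.
by apply: le_trans (lerD (key a c) (key b e)) _; rewrite le_eqVlt; apply/orP; left;
  apply/eqP; ring.
Qed.

End complex_facts.

Section complex_measurable.
Context {R : realType} {n : nat}.
Implicit Types f g : n.-tuple R -> R[i].

Lemma cmeasurableD f g : cmeasurable f -> cmeasurable g ->
  cmeasurable (fun z => f z + g z).
Proof.
move=> [f1 f2] [g1 g2]; split.
  by under [X in measurable_fun _ X]eq_fun do rewrite /= Re_addc; exact: measurable_funD.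
by under [X in measurable_fun _ X]eq_fun do rewrite /= Im_addc; exact: measurable_funD.
Qed.

Lemma cmeasurableM f g : cmeasurable f -> cmeasurable g ->
  cmeasurable (fun z => f z * g z).
Proof.
move=> [f1 f2] [g1 g2]; split.
  under [X in measurable_fun _ X]eq_fun do rewrite /= Re_mulc.
  by apply: measurable_funB; exact: measurable_funM.
under [X in measurable_fun _ X]eq_fun do rewrite /= Im_mulc.
by apply: measurable_funD; exact: measurable_funM.
Qed.

Lemma cmeasurable_cst (c : R[i]) : cmeasurable (fun _ : n.-tuple R => c).
Proof. by split; exact: measurable_cst. Qed.

Lemma cmeasurableZ c f : cmeasurable f -> cmeasurable (fun z => c * f z).
Proof. by move=> mf; apply: cmeasurableM => //; exact: cmeasurable_cst. Qed.

Lemma cmeasurableN f : cmeasurable f -> cmeasurable (fun z => - f z).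
Proof. by move=> mf; under eq_fun do rewrite -mulN1r; exact: cmeasurableZ. Qed.

Lemma cmeasurableB f g : cmeasurable f -> cmeasurable g ->
  cmeasurable (fun z => f z - g z).
Proof. by move=> mf mg; apply: cmeasurableD => //; exact: cmeasurableN. Qed.

Lemma cmeasurable_conj f : cmeasurable f -> cmeasurable (fun z => conjc (f z)).
Proof.
move=> [f1 f2]; split.
  by under [X in measurable_fun _ X]eq_fun do rewrite /= Re_conjc.
under [X in measurable_fun _ X]eq_fun do rewrite /= Im_conjc.
exact: measurableT_comp.
Qed.

Lemma cmeasurable_sum I (s : seq I) (F : I -> n.-tuple R -> R[i]) :
  (forall i, cmeasurable (F i)) -> cmeasurable (fun z => \sum_(i <- s) F i z).
Proof.
move=> mF; elim: s => [|i s IHs].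
  by under eq_fun do rewrite big_nil; exact: cmeasurable_cst.
by under eq_fun do rewrite big_cons; exact: cmeasurableD.
Qed.

Lemma cmeasurable_real (h : n.-tuple R -> R) : measurable_fun setT h ->
  cmeasurable (fun z => (h z)%:C).
Proof. by move=> mh; split => //; exact: measurable_cst. Qed.

Lemma measurable_sqmod f : cmeasurable f -> measurable_fun setT (fun z => sqmod (f z)).
Proof.
by move=> [f1 f2]; apply: measurable_funD; exact: measurable_funX.
Qed.

(** Reduces the imaginary part of [expi] to the cosine lemmas, with phase -pi/2. *)
Lemma sin_cos_shift (x : R) : sin x = cos (- (pi / 2) + x).
Proof. by rewrite cosD cosN cos_pihalf sinN sin_pihalf mul0r mulN1r sub0r opprK. Qed.

Lemma cmeasurable_expi (q : 'cV[R]_n) : cmeasurable (expi q).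
Proof.
split; rewrite /expi /comp /=.
  under [X in measurable_fun _ X]eq_fun do rewrite -[X in cos X]add0r.
  exact: measurable_cos_dot.
under [X in measurable_fun _ X]eq_fun do rewrite sin_cos_shift.
exact: measurable_cos_dot.
Qed.

Lemma expiB (p q : 'cV[R]_n) z : expi p z * conjc (expi q z) = expi (p - q) z.
Proof.
rewrite /expi (_ : \sum_j (p - q) j 0 * tnth z j =
  \sum_j p j 0 * tnth z j - \sum_j q j 0 * tnth z j); last first.
  by rewrite -sumrB; apply: eq_bigr => j _; rewrite !mxE mulrBl.
by apply: complex_eqP; rewrite !ReImE /= ?cosB ?sinB; ring.
Qed.

Lemma expiD (p q : 'cV[R]_n) z : expi (p + q) z = expi p z * expi q z.
Proof.
rewrite /expi (_ : \sum_j (p + q) j 0 * tnth z j =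
  \sum_j p j 0 * tnth z j + \sum_j q j 0 * tnth z j); last first.
  by rewrite -big_split; apply: eq_bigr => j _; rewrite !mxE mulrDl.
by apply: complex_eqP; rewrite !ReImE /= ?cosD ?sinD; ring.
Qed.

Lemma sqmod_expi (q : 'cV[R]_n) z : sqmod (expi q z) = 1.
Proof. by rewrite /sqmod /= cos2Dsin2. Qed.

End complex_measurable.

Section complex_mean.
Context {R : realType}.
Local Notation C := R[i].
Local Notation E := (3.-tuple R).
Implicit Types (f g : E -> C) (l : C).

Definition has_mean f l :=
  has_rmean (@complex.Re R \o f) (complex.Re l) /\
  has_rmean (@complex.Im R \o f) (complex.Im l).

Lemma has_mean_mean f l : has_mean f l -> mean f = l.
Proof.
move=> [m1 m2]; rewrite /mean (has_rmean_lim m1) (has_rmean_lim m2).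
by case: l {m1 m2}.
Qed.

Lemma has_mean_unique f l1 l2 : has_mean f l1 -> has_mean f l2 -> l1 = l2.
Proof. by move=> /has_mean_mean <- /has_mean_mean <-. Qed.

Lemma has_mean_Re f l : has_mean f l ->
  has_rmean (fun z => complex.Re (f z)) (complex.Re l).
Proof. by case. Qed.

Lemma has_meanD f g l1 l2 : has_mean f l1 -> has_mean g l2 ->
  has_mean (fun z => f z + g z) (l1 + l2).
Proof.
move=> [f1 f2] [g1 g2]; split; rewrite /comp.
  by under eq_fun do rewrite Re_addc; rewrite Re_addc; exact: has_rmeanD.
by under eq_fun do rewrite Im_addc; rewrite Im_addc; exact: has_rmeanD.
Qed.

Lemma has_meanZ c f l : has_mean f l -> has_mean (fun z => c * f z) (c * l).
Proof.
move=> [f1 f2]; split; rewrite /comp.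
  under eq_fun do rewrite Re_mulc; rewrite Re_mulc.
  by apply: has_rmeanB; exact: has_rmeanZ.
under eq_fun do rewrite Im_mulc; rewrite Im_mulc.
by apply: has_rmeanD; exact: has_rmeanZ.
Qed.

Lemma has_meanN f l : has_mean f l -> has_mean (fun z => - f z) (- l).
Proof.
by move=> /(has_meanZ (-1)); rewrite mulN1r; under eq_fun do rewrite mulN1r.
Qed.

Lemma has_meanB f g l1 l2 : has_mean f l1 -> has_mean g l2 ->
  has_mean (fun z => f z - g z) (l1 - l2).
Proof. by move=> m1 /has_meanN; exact: has_meanD. Qed.

Lemma has_mean0 : has_mean (fun _ : E => 0) 0.
Proof.
have h0 : has_rmean (fun _ : E => 0 : R) 0.
  have := has_rmeanZ 0 (has_rmean_cos 0 (fun=> 0 : R)).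
  by under eq_fun do rewrite mul0r; rewrite mul0r.
by split.
Qed.

Lemma has_mean_sum I (s : seq I) (F : I -> E -> C) (l : I -> C) :
  (forall i, has_mean (F i) (l i)) ->
  has_mean (fun z => \sum_(i <- s) F i z) (\sum_(i <- s) l i).
Proof.
move=> mF; elim: s => [|i s IHs].
  by rewrite big_nil; under eq_fun do rewrite big_nil; exact: has_mean0.
by rewrite big_cons; under eq_fun do rewrite big_cons; exact: has_meanD.
Qed.

Lemma has_mean_expi (q : 'cV[R]_3) : has_mean (expi q) (q == 0)%:R.
Proof.
have -> : (q == 0)%:R = (\prod_j (q j 0 == 0)%:R : R)%:C.
  have [->|q0] := eqVneq q 0.
    by rewrite big1// => j _; rewrite mxE eqxx.
  have [j qj] : exists j, q j 0 != 0.
    apply/existsP; apply: contraNT q0; rewrite negb_exists => /forallP h.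
    by apply/eqP/colP => j; rewrite mxE; apply/eqP; rewrite -[_ == _]negbK.
  by rewrite (bigD1 j)//= (negbTE qj) mul0r.
split; rewrite /= /comp /expi /=.
  have := has_rmean_cos 0 (fun j => q j 0); rewrite cos0 mulr1.
  by under eq_fun do rewrite add0r.
have := has_rmean_cos (- (pi / 2)) (fun j => q j 0); rewrite cosN cos_pihalf mulr0.
by under eq_fun do rewrite -sin_cos_shift.
Qed.

End complex_mean.

(** * The Besicovitch class *)

Section besicovitch.
Context {R : realType}.
Local Notation C := R[i].
Local Notation E := (3.-tuple R).
Implicit Types (f g h : E -> C) (e : R).

(** An eventual bound on the averages in place of a bound on the seminorm: it makes sense before the
    mean of |h|^2 is known to exist. *)
Definition mean_sq_le e h :=
  [/\ cmeasurable h, locint (fun z => sqmod (h z)) &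
      \forall L \near +oo%R, avg L (fun z => sqmod (h z)) <= e].

Lemma mean_sq_le_weak e1 e2 h : e1 <= e2 -> mean_sq_le e1 h -> mean_sq_le e2 h.
Proof.
move=> e12 [mh ih nh]; split => //.
by apply: filterS nh => L /le_trans; exact.
Qed.

Lemma mean_sq_le0 : mean_sq_le 0 (fun=> 0).
Proof.
have h0 : has_rmean (fun _ : E => sqmod (0 : C)) 0.
  by rewrite sqmod0; exact: (has_mean0).1.
split; [exact: cmeasurable_cst | exact: h0.1 | ].
apply: near_pinfty_gt0 => L L0; rewrite sqmod0 /avg Rintegral_cst ?mul0r ?mulr0//.
exact: measurable_cube.
Qed.

Lemma mean_sq_leD e1 e2 f g : mean_sq_le e1 f -> mean_sq_le e2 g ->
  mean_sq_le (2 * e1 + 2 * e2) (fun z => f z + g z).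
Proof.
move=> [mf lf nf] [mg lg ng].
have mfg := cmeasurableD mf mg.
have l2 : locint (fun z => 2 * sqmod (f z) + 2 * sqmod (g z)).
  by apply: locintD; exact: locintZ.
have lfg : locint (fun z => sqmod (f z + g z)).
  apply: locint_le l2; first exact: measurable_sqmod.
  by move=> z; rewrite ger0_norm ?sqmod_ge0//; exact: sqmodD_le.
split => //; near=> L.
have L0 : 0 < L by near: L; apply: nbhs_pinfty_gt.
apply: (le_trans (le_avg L0 lfg l2 _)) => [z|]; first exact: sqmodD_le.
rewrite avgD ?avgZ//; try exact: locintZ.
by apply: lerD; rewrite ler_pM2l//; near: L.
Unshelve. all: by end_near. Qed.

Lemma mean_sq_leM e M b f : cmeasurable b -> (forall z, sqmod (b z) <= M) ->
  mean_sq_le e f -> mean_sq_le (M * e) (fun z => b z * f z).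
Proof.
move=> mb bM [mf lf nf].
have M0 : 0 <= M by apply: le_trans (bM [tuple of nseq 3 0]); exact: sqmod_ge0.
have mbf := cmeasurableM mb mf.
have l2 : locint (fun z => M * sqmod (f z)) by exact: locintZ.
have lbf : locint (fun z => sqmod (b z * f z)).
  apply: locint_le l2; first exact: measurable_sqmod.
  move=> z; rewrite ger0_norm ?sqmod_ge0// sqmodM ler_wpM2r ?sqmod_ge0//.
split => //; near=> L.
have L0 : 0 < L by near: L; apply: nbhs_pinfty_gt.
apply: (le_trans (le_avg L0 lbf l2 _)) => [z|].
  by rewrite sqmodM ler_wpM2r ?sqmod_ge0.
by rewrite avgZ// ler_wpM2l//; near: L.
Unshelve. all: by end_near. Qed.

Lemma mean_sq_leZ e c f : mean_sq_le e f ->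
  mean_sq_le (sqmod c * e) (fun z => c * f z).
Proof. by apply: mean_sq_leM => //; exact: cmeasurable_cst. Qed.

Section tpolys.
Context {n : nat}.
Implicit Types (s : seq 'cV[int]_n) (c : 'cV[int]_n -> C).

(** In [tpoly] a coefficient depends on the frequency alone, so sums and products of polynomials,
    which repeat frequencies, must first be collected. The duplicate-free list is what the
    orthogonality arguments use. *)
Lemma tpoly_pairs (l : seq ('cV[int]_n * C)) : exists s c, uniq s /\
  forall y : n.-tuple R, tpoly s c y = \sum_(p <- l) p.2 * expi (ivec R p.1) y.
Proof.
exists (undup (map fst l)), (fun k => \sum_(p <- l | p.1 == k) p.2).
split=> [|y]; first exact: undup_uniq.
rewrite /tpoly; under eq_bigr do rewrite mulr_suml big_mkcond.
rewrite exchange_big /=; apply: eq_big_seq => p pl.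
rewrite -big_mkcond; under eq_bigl do rewrite eq_sym.
by rewrite -big_filter filter_pred1_uniq ?big_seq1 ?undup_uniq// mem_undup map_f.
Qed.

Lemma tpoly_uniq s c : exists s' c', uniq s' /\
  forall y : n.-tuple R, tpoly s' c' y = tpoly s c y.
Proof.
have [s' [c' [us' E']]] := tpoly_pairs [seq (k, c k) | k <- s].
by exists s', c'; split => // y; rewrite E' big_map.
Qed.

Lemma tpolyD s1 c1 s2 c2 : exists s c,
  forall y : n.-tuple R, tpoly s c y = tpoly s1 c1 y + tpoly s2 c2 y.
Proof.
have [s [c [_ E']]] := tpoly_pairs ([seq (k, c1 k) | k <- s1] ++ [seq (k, c2 k) | k <- s2]).
by exists s, c => y; rewrite E' big_cat !big_map.
Qed.

Lemma tpolyZ (a : C) s c (y : n.-tuple R) :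
  tpoly s (fun k => a * c k) y = a * tpoly s c y.
Proof. by rewrite /tpoly mulr_sumr; apply: eq_bigr => k _; rewrite mulrA. Qed.

Lemma ivecD (k l : 'cV[int]_n) : ivec R (k + l) = ivec R k + ivec R l.
Proof. by apply/colP => j; rewrite !mxE intrD. Qed.

Lemma ivecB (k l : 'cV[int]_n) : ivec R (k - l) = ivec R k - ivec R l.
Proof. by apply/colP => j; rewrite !mxE intrB. Qed.

Lemma tpolyM s1 c1 s2 c2 : exists s c,
  forall y : n.-tuple R, tpoly s c y = tpoly s1 c1 y * tpoly s2 c2 y.
Proof.
have [s [c [_ E']]] := tpoly_pairs [seq (k + l, c1 k * c2 l) | k <- s1, l <- s2].
exists s, c => y; rewrite E' big_allpairs_dep /= /tpoly mulr_suml.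
apply: eq_bigr => k _; rewrite mulr_sumr; apply: eq_bigr => l _ /=.
by rewrite ivecD expiD mulrACA.
Qed.

Lemma cmeasurable_tpoly s c : cmeasurable (@tpoly R n s c).
Proof.
by apply: cmeasurable_sum => k; apply: cmeasurableZ; exact: cmeasurable_expi.
Qed.

Lemma tpoly_bounded s c : exists M : R, forall y : n.-tuple R, sqmod (tpoly s c y) <= M.
Proof.
rewrite /tpoly; elim: s => [|k s [M hM]].
  by exists 0 => y; rewrite big_nil sqmod0.
exists (2 * sqmod (c k) + 2 * M) => y; rewrite big_cons.
apply: le_trans (sqmodD_le _ _) _; rewrite sqmodM sqmod_expi mulr1.
by rewrite lerD2l ler_pM2l.
Qed.

End tpolys.

Context {n : nat} (P : 'M[R]_(3, n)).
Implicit Types (s : seq 'cV[int]_n) (c : 'cV[int]_n -> C).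

(** The adjoint identity <k, P^T z> = <P k, z>. *)
Lemma expi_projT (k : 'cV[int]_n) (z : E) :
  expi (ivec R k) (projT P z) = expi (freq P k) z.
Proof.
rewrite /expi; congr cexp; under eq_bigr do rewrite tnth_mktuple mulr_sumr.
rewrite exchange_big; apply: eq_bigr => i _; rewrite !mxE mulr_suml.
by apply: eq_bigr => j _; rewrite !mxE; ring.
Qed.

Lemma tpoly_projT s c (z : E) :
  tpoly s c (projT P z) = \sum_(k <- s) c k * expi (freq P k) z.
Proof. by apply: eq_bigr => k _; rewrite expi_projT. Qed.

Lemma cmeasurable_tpoly_projT s c : cmeasurable (fun z : E => tpoly s c (projT P z)).
Proof.
under eq_fun do rewrite tpoly_projT.
by apply: cmeasurable_sum => k; apply: cmeasurableZ; exact: cmeasurable_expi.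
Qed.

(** Only the half of [is_parent] that lives on R^3 is kept: the product of 1/epsilon with a curl is
    then handled without building a parent for it. *)
Definition besicovitch f := cmeasurable f /\
  forall e, 0 < e -> exists s c, mean_sq_le e (fun z => f z - tpoly s c (projT P z)).

Lemma besicovitch_tpoly s c : besicovitch (fun z => tpoly s c (projT P z)).
Proof.
split=> [|e e0]; first exact: cmeasurable_tpoly_projT.
exists s, c; under eq_fun do rewrite subrr.
exact: mean_sq_le_weak (ltW e0) mean_sq_le0.
Qed.

Lemma besicovitch_expi (k : 'cV[int]_n) : besicovitch (expi (freq P k)).
Proof.
have := besicovitch_tpoly [:: k] (fun=> 1).
by under eq_fun do rewrite tpoly_projT big_seq1 mul1r.
Qed.

Lemma besicovitch_closed f : cmeasurable f ->
  (forall e, 0 < e -> exists g, besicovitch g /\ mean_sq_le e (fun z => f z - g z)) ->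
  besicovitch f.
Proof.
move=> mf fg; split => // e e0.
(* A quarter, because [mean_sq_leD] doubles each of the two errors. *)
have e4 : 0 < e / 4 by rewrite divr_gt0.
have [g [[mg bg] sg]] := fg _ e4; have [s [c sc]] := bg _ e4.
exists s, c; have := mean_sq_leD sg sc.
under eq_fun do rewrite addrA subrK.
by apply: mean_sq_le_weak; lra.
Qed.

Lemma besicovitchD f g : besicovitch f -> besicovitch g ->
  besicovitch (fun z => f z + g z).
Proof.
move=> [mf bf] [mg bg]; split=> [|e e0]; first exact: cmeasurableD.
have e4 : 0 < e / 4 by rewrite divr_gt0.
have [s1 [c1 h1]] := bf _ e4; have [s2 [c2 h2]] := bg _ e4.
have [s [c E']] := tpolyD s1 c1 s2 c2.
exists s, c; have := mean_sq_leD h1 h2.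
under eq_fun do rewrite addrACA -opprD -E'.
by apply: mean_sq_le_weak; lra.
Qed.

(** With polynomials T1 near f and T2 near b, b f - T2 T1 = b (f - T1) + T1 (b - T2). The order of
    choices matters: T1 comes first, and T2 is then chosen according to the bound K of |T1|^2.
    Adding 1 to M and K keeps the denominators positive. *)
Lemma besicovitchM f b (M : R) : (forall z, sqmod (b z) <= M) -> besicovitch b ->
  besicovitch f -> besicovitch (fun z => b z * f z).
Proof.
move=> bM [mb bb] [mf bf].
have M0 : 0 <= M by apply: le_trans (bM [tuple of nseq 3 0]); exact: sqmod_ge0.
have M1 : 0 < M + 1 by rewrite ltr_wpDl.
split=> [|e e0]; first exact: cmeasurableM.
have e1 : 0 < e / (4 * (M + 1)) by rewrite divr_gt0// mulr_gt0.
have [s1 [c1 h1]] := bf _ e1.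
have [K hK] := tpoly_bounded s1 c1.
have K0 : 0 <= K by apply: le_trans (hK [tuple of nseq n 0]); exact: sqmod_ge0.
have K1 : 0 < K + 1 by rewrite ltr_wpDl.
have e2 : 0 < e / (4 * (K + 1)) by rewrite divr_gt0// mulr_gt0.
have [s2 [c2 h2]] := bb _ e2.
have [s [c E']] := tpolyM s1 c1 s2 c2.
exists s, c.
have := mean_sq_leD (mean_sq_leM mb bM h1)
  (mean_sq_leM (cmeasurable_tpoly_projT s1 c1) (fun z => hK (projT P z)) h2).
rewrite (_ : (fun z => _) = (fun z => b z * f z - tpoly s c (projT P z))); last first.
  by apply/funext => z; rewrite E'; ring.
apply: mean_sq_le_weak.
have h (x : R) : 0 <= x -> 2 * (x * (e / (4 * (x + 1)))) <= e / 2.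
  move=> x0; have x1 : 0 < x + 1 by rewrite ltr_wpDl.
  rewrite (_ : 2 * _ = (x / (x + 1)) * (e / 2)); last by field; rewrite gt_eqF.
  by rewrite ler_piMl ?divr_ge0 ?ltW// ltr_pdivrMr// mul1r ltrDl.
by rewrite (le_trans (lerD (h _ M0) (h _ K0)))//; lra.
Qed.

Lemma besicovitchZ a f : besicovitch f -> besicovitch (fun z => a * f z).
Proof.
move=> [mf bf]; split=> [|e e0]; first exact: cmeasurableZ.
have a1 : 0 < sqmod a + 1 by rewrite ltr_wpDl ?sqmod_ge0.
have e1 : 0 < e / (sqmod a + 1) by rewrite divr_gt0.
have [s [c h]] := bf _ e1.
exists s, (fun k => a * c k); have := mean_sq_leZ a h.
under eq_fun do rewrite mulrBr -tpolyZ.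
apply: mean_sq_le_weak.
rewrite mulrCA ler_piMr ?ltW// ltr_pdivrMr// mul1r ltrDl//.
Qed.

Lemma besicovitchN f : besicovitch f -> besicovitch (fun z => - f z).
Proof. by under [in X in _ -> X]eq_fun do rewrite -mulN1r; exact: besicovitchZ. Qed.

Lemma besicovitchB f g : besicovitch f -> besicovitch g ->
  besicovitch (fun z => f z - g z).
Proof. by move=> bf /besicovitchN; exact: besicovitchD. Qed.

Lemma has_rmean_sqmod_tpoly s c :
  exists l, has_rmean (fun z : E => sqmod (tpoly s c (projT P z))) l.
Proof.
pose F k l (z : E) := c k * (conjc (c l) * expi (freq P k - freq P l) z).
exists (complex.Re (\sum_(k <- s) \sum_(l <- s)
  c k * (conjc (c l) * (freq P k - freq P l == 0)%:R))).
have -> : (fun z : E => sqmod (tpoly s c (projT P z))) =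
    fun z => complex.Re (\sum_(k <- s) \sum_(l <- s) F k l z).
  apply/funext => z; rewrite sqmodE tpoly_projT rmorph_sum/= mulr_suml.
  congr complex.Re; apply: eq_bigr => k _; rewrite mulr_sumr.
  apply: eq_bigr => l _; rewrite /F -expiB rmorphM /=.
  by ring.
apply: (@has_mean_Re R (fun z => \sum_(k <- s) \sum_(l <- s) F k l z)).
do 2 (apply: has_mean_sum => ?).
by do 2 apply: has_meanZ; exact: has_mean_expi.
Qed.

Lemma locint_sqmod f : besicovitch f -> locint (fun z => sqmod (f z)).
Proof.
move=> [mf /(_ 1 ltr01)[s [c [ms ls _]]]].
have [l [lT _]] := has_rmean_sqmod_tpoly s c.
apply: locint_le (locintD (locintZ 2 ls) (locintZ 2 lT)).
  exact: measurable_sqmod.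
move=> z; rewrite ger0_norm ?sqmod_ge0//.
by rewrite -{1}(subrK (tpoly s c (projT P z)) (f z)); exact: sqmodD_le.
Qed.

(** The averages of |f|^2 are first bounded by some K, then compared by [sqmodB_le] with those of
    |T|^2 for a polynomial T near f; the latter converge, so [has_rmean_approx] applies. *)
Lemma besicovitch_sqmod f : besicovitch f ->
  exists l, has_rmean (fun z => sqmod (f z)) l.
Proof.
move=> bf; have lf := locint_sqmod bf; case: bf => mf bf.
have [K K0 nK] : exists2 K : R, 0 < K &
    \forall L \near +oo%R, avg L (fun z => sqmod (f z)) <= K.
  have [s [c [ms ls ns]]] := bf _ ltr01.
  have [l [lT cT]] := has_rmean_sqmod_tpoly s c.
  (* |f|^2 <= 2 |f - T|^2 + 2 |T|^2, where the first mean square is eventually at most 1 and the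
     second at most |l| + 1. *)
  exists (2 + 2 * (`|l| + 1)).
    by rewrite addr_gt0// mulr_gt0// ltr_wpDl.
  near=> L; have L0 : 0 < L by near: L; apply: nbhs_pinfty_gt.
  apply: (le_trans (le_avg L0 lf (locintD (locintZ 2 ls) (locintZ 2 lT)) _)) => [z|].
    by rewrite -{1}(subrK (tpoly s c (projT P z)) (f z)); exact: sqmodD_le.
  rewrite avgD ?avgZ//; try exact: locintZ.
  rewrite lerD//.
    by rewrite -[leRHS]mulr1 ler_pM2l//; near: L.
  rewrite ler_pM2l//.
  have : `|l - avg L (fun z => sqmod (tpoly s c (projT P z)))| <= 1.
    by near: L; move/cvgrPdist_le: cT; apply.
  by rewrite ler_distl => /andP[]; have := ler_norm l; lra.
apply: has_rmean_approx => // e e0.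
(* Half of e pays for d K, the other half for (1 + 1/d) times the mean-square error of T. *)
pose d := e / (2 * K).
have d0 : 0 < d by rewrite divr_gt0// mulr_gt0.
have d1 : 0 < 1 + d^-1 by rewrite addr_gt0// invr_gt0.
have e1 : 0 < e / 2 / (1 + d^-1) by rewrite !divr_gt0.
have [s [c [ms ls ns]]] := bf _ e1.
have [l measurable_torus_cube] := has_rmean_sqmod_tpoly s c; have lT := measurable_torus_cube.1.
exists (fun z => sqmod (tpoly s c (projT P z))), l; split => //.
near=> L; have L0 : 0 < L by near: L; apply: nbhs_pinfty_gt.
have lhs : locint (fun z => sqmod (f z) - sqmod (tpoly s c (projT P z))).
  by apply: locintD => //; exact: locintN.
have lrhs : locint (fun z => d * sqmod (f z) +
    (1 + d^-1) * sqmod (f z - tpoly s c (projT P z))).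
  by apply: locintD; exact: locintZ.
have bnd z := @sqmodB_le R (f z) (tpoly s c (projT P z)) d d0.
have avgE : avg L (fun z => sqmod (f z)) - avg L (fun z => sqmod (tpoly s c (projT P z))) =
    avg L (fun z => sqmod (f z) - sqmod (tpoly s c (projT P z))).
  rewrite (avgD L0 lf (locintN lT)); congr (_ + _).
  by under [in RHS]eq_fun do rewrite -mulN1r; rewrite avgZ// mulN1r.
have le_rhs : avg L (fun z => d * sqmod (f z) +
    (1 + d^-1) * sqmod (f z - tpoly s c (projT P z))) <= e.
  rewrite avgD ?avgZ//; try exact: locintZ.
  have h1 : d * avg L (fun z => sqmod (f z)) <= d * K.
    by rewrite ler_pM2l//; near: L.
  have h2 : (1 + d^-1) * avg L (fun z => sqmod (f z - tpoly s c (projT P z))) <= e / 2.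
    rewrite mulrC -ler_pdivlMr//; near: L; exact: ns.
  have -> : e = d * K + e / 2 by rewrite /d; field; rewrite gt_eqF.
  exact: lerD.
rewrite avgE ler_norml; apply/andP; split; last first.
  apply: le_trans le_rhs; apply: le_avg => // z.
  exact: le_trans (ler_norm _) (bnd z).
rewrite lerNl; apply: le_trans le_rhs.
rewrite -mulN1r -avgZ//; apply: le_avg => //; first exact: locintZ.
move=> z; rewrite mulN1r; apply: le_trans (bnd z).
by rewrite -normrN ler_norm.
Unshelve. all: by end_near. Qed.

(** Polarization: 2 Re (a f conj g) = |a f + g|^2 - |a f|^2 - |g|^2. Taking a = 1 gives the real
    part and a = -i the imaginary part. *)
Lemma has_mean_ip f g : besicovitch f -> besicovitch g ->
  has_mean (fun z => f z * conjc (g z)) (qp_ip f g).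
Proof.
move=> bf bg.
have Re_ip a : exists l, has_rmean (fun z => complex.Re (a * f z * conjc (g z))) l.
  have baf := besicovitchZ a bf.
  have [l1 m1] := besicovitch_sqmod (besicovitchD baf bg).
  have [l2 m2] := besicovitch_sqmod baf; have [l3 m3] := besicovitch_sqmod bg.
  exists (2^-1 * (l1 - l2 - l3)).
  have := has_rmeanZ 2^-1 (has_rmeanB (has_rmeanB m1 m2) m3).
  congr (has_rmean _ _); apply/funext => z.
  by rewrite /sqmod !ReImE; field.
have [l1 m1] := Re_ip 1; have [l2 m2] := Re_ip (- 'i%C).
have m : has_mean (fun z => f z * conjc (g z)) (l1 +i* l2).
  split; rewrite /=.
    by move: m1; congr has_rmean; apply/funext => z /=; rewrite mul1r.
  move: m2; congr has_rmean; apply/funext => z /=.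
  by rewrite !ReImE /=; ring.
by rewrite /qp_ip (has_mean_mean m).
Qed.

Lemma has_rmean_sqmod f : besicovitch f ->
  has_rmean (fun z => sqmod (f z)) (complex.Re (qp_ip f f)).
Proof.
move=> bf; have [m _] := has_mean_ip bf bf.
by move: m; congr has_rmean; apply/funext => z /=; rewrite sqmodE.
Qed.

Lemma has_mean_coef f (k : 'cV[int]_n) : besicovitch f ->
  has_mean (fun z => f z * conjc (expi (freq P k) z)) (qp_coef f (freq P k)).
Proof. by move=> bf; apply: has_mean_ip => //; exact: besicovitch_expi. Qed.

Lemma qp_coefB f g (k : 'cV[int]_n) : besicovitch f -> besicovitch g ->
  qp_coef (fun z => f z - g z) (freq P k) =
  qp_coef f (freq P k) - qp_coef g (freq P k).
Proof.
move=> bf bg; apply: has_mean_unique (has_mean_coef k (besicovitchB bf bg)) _.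
have := has_meanB (has_mean_coef k bf) (has_mean_coef k bg).
by under eq_fun do rewrite -mulrBl.
Qed.

Lemma freq_eq0 (k : 'cV[int]_n) : Qindep P -> (freq P k == 0) = (k == 0).
Proof.
move=> iP; apply/eqP/eqP => [Pk|->]; last first.
  by apply/colP => j; rewrite !mxE big1// => i _; rewrite !mxE mulr0.
have /colP k0 : map_mx (intr : int -> rat) k = 0.
  apply: iP; rewrite -[RHS]Pk /freq; congr (_ *m _).
  by apply/colP => j; rewrite !mxE ratr_int.
by apply/colP => j; have := k0 j; rewrite !mxE => /eqP; rewrite intr_eq0 => /eqP.
Qed.

Lemma freqB (k l : 'cV[int]_n) : freq P (k - l) = freq P k - freq P l.
Proof. by rewrite /freq ivecB mulmxBr. Qed.

Lemma qp_coef_tpoly s c (k : 'cV[int]_n) : Qindep P ->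
  qp_coef (fun z => tpoly s c (projT P z)) (freq P k) =
  \sum_(l <- s | l == k) c l.
Proof.
move=> iP; apply: has_mean_unique (has_mean_coef k (besicovitch_tpoly s c)) _.
rewrite big_mkcond /=.
have -> : (fun z : E => tpoly s c (projT P z) * conjc (expi (freq P k) z)) =
    fun z => \sum_(l <- s) c l * expi (freq P (l - k)) z.
  apply/funext => z; rewrite tpoly_projT mulr_suml; apply: eq_bigr => l _.
  by rewrite -mulrA expiB freqB.
apply: has_mean_sum => l; have := has_meanZ (c l) (has_mean_expi (freq P (l - k))).
by rewrite freq_eq0// subr_eq0; case: ifP; rewrite ?mulr1 ?mulr0.
Qed.

Lemma has_rmean_Re_ip_tpoly f s c : besicovitch f ->
  has_rmean (fun z => complex.Re (f z * conjc (tpoly s c (projT P z))))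
    (complex.Re (\sum_(k <- s) conjc (c k) * qp_coef f (freq P k))).
Proof.
move=> bf; apply: has_mean_Re.
have -> : (fun z : E => f z * conjc (tpoly s c (projT P z))) =
    fun z => \sum_(k <- s) conjc (c k) * (f z * conjc (expi (freq P k) z)).
  apply/funext => z; rewrite tpoly_projT rmorph_sum mulr_sumr.
  by apply: eq_bigr => l _; rewrite rmorphM /=; ring.
by apply: has_mean_sum => k; apply: has_meanZ; exact: has_mean_coef.
Qed.

(** Completing the square in each coefficient: |c|^2 - 2 Re (conj c a) = |a - c|^2 - |a|^2. Choosing
    for c the coefficients of f yields Bessel; an arbitrary c shows that the partial sum is the best
    approximation. *)
Lemma has_rmean_sqmod_sub_tpoly f s c : Qindep P -> uniq s -> besicovitch f ->
  has_rmean (fun z => sqmod (f z - tpoly s c (projT P z)))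
    (complex.Re (qp_ip f f) - \sum_(k <- s) sqmod (qp_coef f (freq P k))
     + \sum_(k <- s) sqmod (qp_coef f (freq P k) - c k)).
Proof.
move=> iP us bf.
have m1 := has_rmean_sqmod bf.
have m2 := has_rmeanZ 2 (has_rmean_Re_ip_tpoly s c bf).
(* The mean of |T|^2, read as the inner product of the polynomial with itself. *)
have m3 := has_rmean_Re_ip_tpoly s c (besicovitch_tpoly s c).
have := has_rmeanD (has_rmeanB m1 m2) m3.
congr has_rmean.
  by apply/funext => z; rewrite /sqmod !ReImE; ring.
rewrite !Re_sum mulr_sumr -!addrA; congr (_ + _).
rewrite -!sumrN -!big_split /=; apply: eq_big_seq => k ks.
rewrite qp_coef_tpoly// -big_filter filter_pred1_uniq// big_seq1.
by rewrite /sqmod !ReImE; ring.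
Qed.

Lemma bessel f s : Qindep P -> uniq s -> besicovitch f ->
  \sum_(k <- s) sqmod (qp_coef f (freq P k)) <= complex.Re (qp_ip f f).
Proof.
move=> iP us bf.
have m := has_rmean_sqmod_sub_tpoly (fun k => qp_coef f (freq P k)) iP us bf.
have m0 := (@has_mean0 R).1.
have := has_rmean_le m0 m (fun z => sqmod_ge0 _).
rewrite [X in _ + X]big1 ?addr0 ?subr_ge0//= => k _.
by rewrite subrr sqmod0.
Qed.

(* By [has_rmean_sqmod_sub_tpoly], the squared distance from f to a trigonometric
   polynomial with frequencies in s is at least that of f to its own partial sum. *)
Lemma parseval_le f (K : R) : Qindep P -> besicovitch f ->
  (forall s, uniq s -> \sum_(k <- s) sqmod (qp_coef f (freq P k)) <= K) ->
  complex.Re (qp_ip f f) <= K.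
Proof.
move=> iP bf hK; apply/ler_addgt0Pr => e e0.
have [s [c [_ _ n1]]] := bf.2 _ e0.
have [s' [c' [us' E']]] := tpoly_uniq s c.
have m := has_rmean_sqmod_sub_tpoly c' iP us' bf.
have : complex.Re (qp_ip f f) - \sum_(k <- s') sqmod (qp_coef f (freq P k))
     + \sum_(k <- s') sqmod (qp_coef f (freq P k) - c' k) <= e.
  apply: has_rmean_le_near m _; apply: filterS n1 => L.
  by under [in X in _ -> X]eq_fun do rewrite E'.
have := hK _ us'.
have : 0 <= \sum_(k <- s') sqmod (qp_coef f (freq P k) - c' k).
  by apply: sumr_ge0 => k _; exact: sqmod_ge0.
lra.
Qed.

End besicovitch.

(** * Parent functions and Fourier coefficients on the torus *)

Section torus.
Context {R : realType} {n : nat}.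
Local Notation C := R[i].
Local Notation mu := (lebesgue_tuple R n).
Local Notation T := (cube 0 (2 * pi) : set (n.-tuple R)).
Implicit Types (F G h : n.-tuple R -> C).

Lemma pi2_gt0 : 0 < 2 * pi :> R. Proof. by rewrite mulr_gt0// pi_gt0. Qed.

Lemma measurable_torus_cube : measurable T. Proof. exact: measurable_cube. Qed.

Lemma sqmod_integrable h (e : R) : cmeasurable h ->
  (\int[mu]_(y in T) (sqmod (h y))%:E <= e%:E)%E ->
  mu.-integrable T (EFin \o (fun y => sqmod (h y))).
Proof.
move=> mh he; apply/integrableP; split.
  by apply/measurable_EFinP; apply: measurable_funTS; exact: measurable_sqmod.
apply: le_lt_trans (ltry e); apply: le_trans he.
rewrite le_eqVlt; apply/orP; left; apply/eqP; apply: eq_integral => y _.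
by rewrite /= ger0_norm ?sqmod_ge0.
Qed.

Definition cintegrable h :=
  mu.-integrable T (EFin \o (fun y => complex.Re (h y))) /\
  mu.-integrable T (EFin \o (fun y => complex.Im (h y))).

(** L^2 lies in L^1 on the torus, from |t| <= 1 + t^2. *)
Lemma cintegrable_sqmod h : cmeasurable h ->
  mu.-integrable T (EFin \o (fun y => sqmod (h y))) -> cintegrable h.
Proof.
move=> mh ih.
have i1 : mu.-integrable T (EFin \o (fun=> 1)).
  apply: (@bounded_cube_integrable _ _ _ _ _ 1); first exact: ltW pi2_gt0.
    exact: measurable_cst.
  by move=> y; rewrite normr1.
have i2 : mu.-integrable T (EFin \o (fun y => 1 + sqmod (h y))).
  rewrite (_ : _ \o _ = (EFin \o (fun=> 1)) \+ (EFin \o (fun y => sqmod (h y))))//.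
  by apply: integrableD => //; exact: measurable_torus_cube.
split; apply: le_integrable i2; try exact: measurable_torus_cube.
- by apply/measurable_EFinP; apply: measurable_funTS; exact: mh.1.
- move=> y _; have s0 := sqmod_ge0 (h y).
  rewrite /= lee_fin [leRHS]ger0_norm; last by lra.
  rewrite /sqmod ler_norml; apply/andP; split; nra.
- by apply/measurable_EFinP; apply: measurable_funTS; exact: mh.2.
- move=> y _; have s0 := sqmod_ge0 (h y).
  rewrite /= lee_fin [leRHS]ger0_norm; last by lra.
  rewrite /sqmod ler_norml; apply/andP; split; nra.
Qed.

Definition torus_mean h : C := ((2 * pi) ^- n)%:C *
  ((\int[mu]_(y in T) complex.Re (h y)) +i* (\int[mu]_(y in T) complex.Im (h y))).

Lemma cintegrableB h1 h2 : cintegrable h1 -> cintegrable h2 ->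
  cintegrable (fun y => h1 y - h2 y).
Proof.
move=> [a1 b1] [a2 b2]; split.
  rewrite (_ : _ \o _ =
    fun y => (complex.Re (h1 y))%:E - (complex.Re (h2 y))%:E)%E.
    by apply: integrableB => //; exact: measurable_torus_cube.
  by apply/funext => y /=; rewrite !ReImE.
rewrite (_ : _ \o _ =
    fun y => (complex.Im (h1 y))%:E - (complex.Im (h2 y))%:E)%E.
    by apply: integrableB => //; exact: measurable_torus_cube.
by apply/funext => y /=; rewrite !ReImE.
Qed.

Lemma torus_meanB h1 h2 : cintegrable h1 -> cintegrable h2 ->
  torus_mean (fun y => h1 y - h2 y) = torus_mean h1 - torus_mean h2.
Proof.
move=> [a1 b1] [a2 b2]; rewrite /torus_mean -mulrBr; congr (_ * _).
under eq_Rintegral do rewrite Re_addc Re_oppc.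
under [in X in _ +i* X]eq_Rintegral do rewrite Im_addc Im_oppc.
rewrite !RintegralB//; exact: measurable_torus_cube.
Qed.

Lemma cintegrable_bounded h (M : R) : cmeasurable h ->
  (forall y, sqmod (h y) <= M) -> cintegrable h.
Proof.
move=> mh hM; apply: cintegrable_sqmod => //.
apply: (@bounded_cube_integrable _ _ _ _ _ M); first exact: ltW pi2_gt0.
  exact: measurable_sqmod.
by move=> y; rewrite ger0_norm ?sqmod_ge0.
Qed.

Lemma torus_mean_sum (I : Type) (s : seq I) (h : I -> n.-tuple R -> C) :
  (forall i, cintegrable (h i)) ->
  torus_mean (fun y => \sum_(i <- s) h i y) = \sum_(i <- s) torus_mean (h i).
Proof.
move=> ih; rewrite /torus_mean -mulr_sumr; congr (_ * _).
under eq_Rintegral do rewrite Re_sum.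
under [in X in _ +i* X]eq_Rintegral do rewrite Im_sum.
(* Integrability of the tail sum is carried along in the induction, since additivity of the integral
   asks for it. *)
have key (g : I -> n.-tuple R -> R) :
    (forall i, mu.-integrable T (EFin \o g i)) ->
    mu.-integrable T (EFin \o (fun y => \sum_(i <- s) g i y)) /\
    \int[mu]_(y in T) (\sum_(i <- s) g i y) = \sum_(i <- s) \int[mu]_(y in T) g i y.
  move=> ig; elim: s => [|i s [IH1 IH2]].
    split.
      rewrite (_ : _ \o _ = cst 0%E); first by apply: integrable0; exact: measurable_torus_cube.
      by apply/funext => y; rewrite /= big_nil.
    rewrite big_nil; under eq_Rintegral do rewrite big_nil.
    by rewrite Rintegral_cst ?mul0r//; exact: measurable_torus_cube.
  split.
    rewrite (_ : _ \o _ = (EFin \o g i) \+ (EFin \o (fun y => \sum_(i <- s) g i y))).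
      by apply: integrableD => //; exact: measurable_torus_cube.
    by apply/funext => y; rewrite /= big_cons.
  rewrite big_cons -IH2; under eq_Rintegral do rewrite big_cons.
  by rewrite RintegralD//; exact: measurable_torus_cube.
rewrite (key _ (fun i => (ih i).1)).2 (key _ (fun i => (ih i).2)).2.
by apply: complex_eqP; rewrite ?Re_sum ?Im_sum.
Qed.

Lemma torus_meanZ c h : cintegrable h ->
  torus_mean (fun y => c * h y) = c * torus_mean h.
Proof.
move=> [a b]; rewrite /torus_mean mulrCA; congr (_ * _).
have iZ k g := @integrable_EFinZ _ _ _ mu T k g measurable_torus_cube.
under eq_Rintegral do rewrite Re_mulc.
under [in X in _ +i* X]eq_Rintegral do rewrite Im_mulc.
have m := measurable_torus_cube.
rewrite RintegralB; [|exact: measurable_torus_cube|exact: iZ|exact: iZ].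
rewrite RintegralD; [|exact: measurable_torus_cube|exact: iZ|exact: iZ].
rewrite !RintegralZl//.
by apply: complex_eqP; rewrite !ReImE.
Qed.

Lemma sin_intpi (k : int) : sin (k%:~R * pi) = 0 :> R.
Proof.
have h (m : nat) : sin (m%:R * pi) = 0 :> R.
  elim: m => [|m IHm]; first by rewrite mul0r sin0.
  by rewrite -natr1 mulrDl mul1r sinD IHm sinpi mul0r mulr0 addr0.
case: k => m; first exact: h.
by rewrite NegzE mulrNz mulNr sinN h oppr0.
Qed.

Lemma torus_mean_expi (k : 'cV[int]_n) :
  torus_mean (expi (ivec R k)) = (k == 0)%:R.
Proof.
have key (th : R) : \int[mu]_(y in T) cos (th + \sum_j ivec R k j 0 * tnth y j) =
    (k == 0)%:R * (2 * pi) ^+ n * cos th.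
  rewrite integral_cos_cube ?pi2_gt0// subr0.
  have [->|k0] := eqVneq k 0.
    rewrite mul1r; congr (_ * cos _).
      rewrite (eq_bigr (fun=> 2 * pi)) ?prodr_const ?card_ord// => j _.
      by rewrite /osc !mxE eqxx.
    by rewrite big1 ?addr0// => j _; rewrite !mxE mul0r.
  rewrite !mul0r.
  have [j kj] : exists j, k j 0 != 0.
    apply/existsP; apply: contraNT k0; rewrite negb_exists => /forallP h.
    by apply/eqP/colP => j; rewrite mxE; apply/eqP; rewrite -[_ == _]negbK.
  rewrite (bigD1 j)//= /osc !mxE intr_eq0 (negbTE kj).
  (* Over a full period the sine in [osc] is taken at an integer multiple of pi. *)
  rewrite (_ : _ * _ / 2 = (k j 0)%:~R * pi); last by field.
  by rewrite sin_intpi mulr0 !mul0r.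
rewrite /torus_mean /expi /=.
under eq_Rintegral do rewrite -[X in cos X]add0r.
under [in X in _ +i* X]eq_Rintegral do rewrite sin_cos_shift.
rewrite !key cos0 cosN cos_pihalf mulr0 mulr1.
rewrite -[X in _ * X]/((_)%:C) -rmorphM /= mulrCA mulVf ?mulr1; last first.
  by rewrite expf_neq0// gt_eqF// pi2_gt0.
by case: (k == 0).
Qed.

Lemma per_coefE F k : per_coef F k =
  torus_mean (fun y => F y * conjc (expi (ivec R k) y)).
Proof. by []. Qed.

Lemma per_coef_tpoly s c (k : 'cV[int]_n) :
  per_coef (@tpoly R n s c) k = \sum_(l <- s | l == k) c l.
Proof.
rewrite per_coefE.
have -> : (fun y => tpoly s c y * conjc (expi (ivec R k) y)) =
    fun y => \sum_(l <- s) c l * expi (ivec R (l - k)) y.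
  apply/funext => y; rewrite /tpoly mulr_suml; apply: eq_bigr => l _.
  by rewrite -mulrA expiB ivecB.
have ie (q : 'cV[R]_n) : cintegrable (expi q).
  apply: (@cintegrable_bounded _ 1); first exact: cmeasurable_expi.
  by move=> y; rewrite sqmod_expi.
rewrite torus_mean_sum.
  rewrite [RHS]big_mkcond; apply: eq_bigr => l _.
  rewrite torus_meanZ// torus_mean_expi subr_eq0.
  by case: ifP; rewrite ?mulr1 ?mulr0.
move=> l; apply: (@cintegrable_bounded _ (sqmod (c l))).
  by apply: cmeasurableZ; exact: cmeasurable_expi.
by move=> y; rewrite sqmodM sqmod_expi mulr1.
Qed.

(** Nonnegativity of the variance: the integral of (h - I1/V)^2 equals (V I2 - I1^2) / V. *)
Lemma jensen_sq (h : n.-tuple R -> R) : mu.-integrable T (EFin \o h) ->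
  mu.-integrable T (EFin \o (fun y => h y ^+ 2)) ->
  (\int[mu]_(y in T) h y) ^+ 2 <= (2 * pi) ^+ n * \int[mu]_(y in T) (h y ^+ 2).
Proof.
move=> ih ih2; set V := (2 * pi) ^+ n; set I1 := \int[mu]_(y in T) h y.
set I2 := \int[mu]_(y in T) (h y ^+ 2).
have V0 : 0 < V by rewrite exprn_gt0// pi2_gt0.
have m := measurable_torus_cube.
have iZ k g := @integrable_EFinZ _ _ _ mu T k g measurable_torus_cube.
have ic (k : R) : mu.-integrable T (EFin \o (fun=> k)).
  apply: (@bounded_cube_integrable _ _ _ _ _ `|k|); first exact: ltW pi2_gt0.
    exact: measurable_cst.
  by [].
have ihh : mu.-integrable T (EFin \o (fun y => h y ^+ 2 + (- (2 * I1 / V)) * h y)).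
  rewrite (_ : _ \o _ = (EFin \o (fun y => h y ^+ 2)) \+
    (EFin \o (fun y => (- (2 * I1 / V)) * h y)))//.
  by apply: integrableD => //; exact: iZ.
have : 0 <= \int[mu]_(y in T) ((h y ^+ 2 + (- (2 * I1 / V)) * h y) + (I1 / V) ^+ 2).
  apply: Rintegral_ge0 => y _.
  rewrite (_ : _ + _ = (h y - I1 / V) ^+ 2) ?sqr_ge0//.
  by field; rewrite gt_eqF.
rewrite RintegralD// RintegralD//; last exact: iZ.
rewrite RintegralZl// Rintegral_cst// -/I1 -/I2.
rewrite [X in fine X](cube_measureE n (ltW pi2_gt0)) subr0 /= -/V.
rewrite (_ : _ + _ = (V * I2 - I1 ^+ 2) / V); last by field; rewrite gt_eqF.
by rewrite pmulr_lge0 ?invr_gt0// subr_ge0.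
Qed.

Lemma sqmod_torus_mean_le h : cmeasurable h ->
  mu.-integrable T (EFin \o (fun y => sqmod (h y))) ->
  sqmod (torus_mean h) <= (2 * pi) ^- n * \int[mu]_(y in T) sqmod (h y).
Proof.
move=> mh ih; have [i1 i2] := cintegrable_sqmod mh ih.
have iSq (g : n.-tuple R -> R) : measurable_fun setT g ->
    (forall y, g y ^+ 2 <= sqmod (h y)) ->
    mu.-integrable T (EFin \o (fun y => g y ^+ 2)).
  move=> mg gh; apply: le_integrable ih; first exact: measurable_torus_cube.
    by apply/measurable_EFinP; apply: measurable_funTS; exact: measurable_funX.
  by move=> y _; rewrite /= lee_fin !ger0_norm ?sqr_ge0 ?sqmod_ge0.
have j1 : mu.-integrable T (EFin \o (fun y => complex.Re (h y) ^+ 2)).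
  by apply: iSq => [|y]; [exact: mh.1 | rewrite lerDl sqr_ge0].
have j2 : mu.-integrable T (EFin \o (fun y => complex.Im (h y) ^+ 2)).
  by apply: iSq => [|y]; [exact: mh.2 | rewrite lerDr sqr_ge0].
have k1 := jensen_sq i1 j1; have k2 := jensen_sq i2 j2.
rewrite (_ : \int[mu]_(y in T) sqmod (h y) =
  \int[mu]_(y in T) (complex.Re (h y) ^+ 2) +
  \int[mu]_(y in T) (complex.Im (h y) ^+ 2)); last first.
  by rewrite -RintegralD//; exact: measurable_torus_cube.
rewrite /torus_mean sqmodM.
move: k1 k2; set V := (2 * pi) ^+ n.
have V0 : 0 < V by rewrite exprn_gt0// pi2_gt0.
move=> k1 k2; rewrite sqmod_real expr2 -mulrA.
rewrite ler_pM2l ?invr_gt0// ler_pdivrMl// [leRHS]mulrDr.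
exact: lerD.
Qed.

End torus.

(** * Coefficients of a function and of its parent; stability of the two function classes *)

Section parents.
Context {R : realType} {n : nat} (P : 'M[R]_(3, n)).
Local Notation C := R[i].
Local Notation E := (3.-tuple R).
Implicit Types (f g : E -> C) (F G : n.-tuple R -> C).

Lemma mean_sq_le_integral f (e : R) : cmeasurable f ->
  (\forall L \near +oo%R, (\int[lebesgue_tuple R 3]_(z in cube (- L) L)
     (sqmod (f z))%:E <= (e * (2 * L) ^+ 3)%:E)%E) ->
  mean_sq_le e f.
Proof.
move=> mf nf.
have ms := measurable_sqmod mf.
have il (L : R) : (\int[lebesgue_tuple R 3]_(z in cube (- L) L)
     (sqmod (f z))%:E <= (e * (2 * L) ^+ 3)%:E)%E ->
    (lebesgue_tuple R 3).-integrable (cube (- L) L) (EFin \o (fun z => sqmod (f z))).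
  move=> h; apply/integrableP; split.
    by apply/measurable_EFinP; exact: measurable_funTS.
  apply: le_lt_trans (ltry (e * (2 * L) ^+ 3)); apply: le_trans h.
  rewrite le_eqVlt; apply/orP; left; apply/eqP; apply: eq_integral => y _.
  by rewrite /= ger0_norm ?sqmod_ge0.
split => //.
  (* The bound is only known for large cubes; a small cube lies in one of them. *)
  move=> L L0; have [M LM hM] := pinfty_ex_ge (num_real L) nf.
  apply: integrableS (il _ hM); [exact: measurable_cube|exact: measurable_cube|].
  move=> z hz i; have /andP[h1 h2] := hz i.
  by rewrite (le_trans _ h1) ?lerN2// (le_trans h2).
near=> L; have L0 : 0 < L by near: L; apply: nbhs_pinfty_gt.
rewrite /avg mulrC ler_pdivrMr ?exprn_gt0 ?mulr_gt0//.
have h : (\int[lebesgue_tuple R 3]_(z in cube (- L) L)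
     (sqmod (f z))%:E <= (e * (2 * L) ^+ 3)%:E)%E by near: L.
rewrite -lee_fin; apply: le_trans h; rewrite /Rintegral fineK//.
by apply: integrable_fin_num (il _ _); [exact: measurable_cube | near: L].
Unshelve. all: by end_near. Qed.

Lemma besicovitch_parent f F : is_parent P f F -> besicovitch P f.
Proof.
move=> [_ mF mf _ happ]; split => // e e0.
have [s [c [_ h]]] := happ _ e0; exists s, c.
apply: mean_sq_le_integral h.
by apply: cmeasurableB => //; exact: cmeasurable_tpoly_projT.
Qed.

Lemma parentP f : L2qp P f -> is_parent P f (parent P f).
Proof. by move=> [F hF]; apply: (@xgetPex _ _ (is_parent P f)); exists F. Qed.

Lemma besicovitch_L2qp f : L2qp P f -> besicovitch P f.
Proof. by move=> [F]; exact: besicovitch_parent. Qed.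

Lemma sqmod_qp_coef_le f (e : R) (k : 'cV[int]_n) : Qindep P -> besicovitch P f ->
  mean_sq_le e f -> sqmod (qp_coef f (freq P k)) <= e.
Proof.
move=> iP bf [_ _ nf]; have := @bessel R n P f [:: k] iP isT bf.
rewrite big_seq1 => /le_trans; apply.
exact: has_rmean_le_near (has_rmean_sqmod bf) nf.
Qed.

(** One and the same polynomial approximates F on the torus and f on R^3. Its two coefficients
    coincide, and each coefficient is continuous for the corresponding mean-square seminorm. *)
Lemma per_coef_parent f F (k : 'cV[int]_n) : Qindep P -> is_parent P f F ->
  per_coef F k = qp_coef f (freq P k).
Proof.
move=> iP pF; have bf := besicovitch_parent pF.
case: pF => _ mF mf _ happ.
pose V := (2 * pi : R) ^+ n.
have V0 : 0 < V by rewrite exprn_gt0// pi2_gt0.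
(* The torus error contributes 2 V^-1 (e/K), with V the volume of the torus, and the error on R^3
   contributes 2 (e/K). *)
pose K := 2 * V^-1 + 2.
have K0 : 0 < K by rewrite addr_gt0// mulr_gt0// invr_gt0.
apply/eqP; rewrite -subr_eq0 -sqmod_eq0 eq_le sqmod_ge0 andbT.
apply/ler_addgt0Pr => e e0; rewrite add0r.
have e1 : 0 < e / K by rewrite divr_gt0.
have [s [c [hF hf]]] := happ _ e1.
pose G y := F y - tpoly s c y.
have mG : cmeasurable G by apply: cmeasurableB => //; exact: cmeasurable_tpoly.
have mGe : cmeasurable (fun y => G y * conjc (expi (ivec R k) y)).
  by apply: cmeasurableM => //; apply: cmeasurable_conj; exact: cmeasurable_expi.
have hGe : (\int[lebesgue_tuple R n]_(y in cube 0 (2 * pi))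
    (sqmod (G y * conjc (expi (ivec R k) y)))%:E <= (e / K)%:E)%E.
  apply: le_trans hF; rewrite le_eqVlt; apply/orP; left; apply/eqP.
  by apply: eq_integral => y _; rewrite sqmodM sqmod_conj sqmod_expi mulr1.
have iGe := sqmod_integrable mGe hGe.
have [M hM] := @tpoly_bounded R n s c.
have iT : cintegrable (fun y => tpoly s c y * conjc (expi (ivec R k) y)).
  apply: (@cintegrable_bounded _ _ _ M).
    apply: cmeasurableM; first exact: cmeasurable_tpoly.
    by apply: cmeasurable_conj; exact: cmeasurable_expi.
  by move=> y; rewrite sqmodM sqmod_conj sqmod_expi mulr1.
have iG := cintegrable_sqmod mGe iGe.
have FE : per_coef F k = torus_mean (fun y => G y * conjc (expi (ivec R k) y))
    + per_coef (@tpoly R n s c) k.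
  apply/eqP; rewrite -subr_eq; apply/eqP; rewrite -[RHS]subr0.
  have iF : cintegrable (fun y => F y * conjc (expi (ivec R k) y)).
    have iN : cintegrable (fun y => 0 - tpoly s c y * conjc (expi (ivec R k) y)).
      apply: cintegrableB iT; apply: (@cintegrable_bounded _ _ _ 0).
        exact: cmeasurable_cst.
      by move=> y; rewrite sqmod0.
    have := cintegrableB iG iN; congr cintegrable; apply/funext => y.
    by rewrite /G; ring.
  rewrite subr0 !per_coefE -torus_meanB//; congr torus_mean.
  by apply/funext => y; rewrite /G mulrBl.
have bT := besicovitch_tpoly P s c.
have fE := qp_coefB k bf bT.
rewrite qp_coef_tpoly// in fE.
have -> : per_coef F k - qp_coef f (freq P k) =
    torus_mean (fun y => G y * conjc (expi (ivec R k) y)) +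
    (- qp_coef (fun z => f z - tpoly s c (projT P z)) (freq P k)).
  by rewrite fE FE per_coef_tpoly; ring.
apply: le_trans (sqmodD_le _ _) _; rewrite sqmodN.
have h1 : sqmod (torus_mean (fun y => G y * conjc (expi (ivec R k) y))) <= V^-1 * (e / K).
  apply: le_trans (sqmod_torus_mean_le mGe iGe) _.
  rewrite ler_pM2l ?invr_gt0// -lee_fin /Rintegral fineK//.
  by apply: integrable_fin_num iGe; exact: measurable_torus_cube.
have h2 : sqmod (qp_coef (fun z => f z - tpoly s c (projT P z)) (freq P k)) <= e / K.
  apply: sqmod_qp_coef_le => //; first exact: besicovitchB.
  apply: mean_sq_le_integral hf.
  by apply: cmeasurableB => //; exact: cmeasurable_tpoly_projT.
have -> : e = 2 * (V^-1 * (e / K)) + 2 * (e / K).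
  by rewrite -[LHS](mulfVK (lt0r_neq0 K0)) {2}/K; ring.
by apply: lerD; rewrite ler_pM2l.
Qed.

Lemma besicovitch_mean_sq_le f : besicovitch P f -> exists K : R, mean_sq_le K f.
Proof.
move=> bf; have [l [lf cf]] := besicovitch_sqmod bf; exists (l + 1).
split=> //; first exact: bf.1.
near=> L.
have : `|l - avg L (fun z => sqmod (f z))| <= 1.
  by near: L; move/cvgrPdist_le: cf; apply.
by rewrite ler_distl => /andP[]; lra.
Unshelve. all: by end_near. Qed.

(* On [a, M], [1/x] is the uniform limit of the partial sums of
   [M^-1 * \sum_j (1 - x/M)^j], i.e. of [x^-1 * (1 - (1 - x/M)^J)]. *)
Lemma besicovitch_inv (eps : E -> R) (a M : R) f : 0 < a ->
  (forall z, a <= eps z <= M) -> besicovitch P (fun z => (eps z)%:C) ->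
  besicovitch P f -> besicovitch P (fun z => ((eps z)^-1)%:C * f z).
Proof.
move=> a0 heps beps bf.
pose z0 : E := [tuple of nseq 3 0].
have aM : a <= M by have /andP[] := heps z0; exact: le_trans.
have M0 : 0 < M by exact: lt_le_trans aM.
have eps0 z : 0 < eps z by have /andP[h _] := heps z; exact: lt_le_trans h.
have epsM z : sqmod (eps z)%:C <= M ^+ 2.
  have /andP[h1 h2] := heps z.
  by rewrite sqmod_real; apply: lerXn2r => //; rewrite nnegrE ltW.
pose r J z := ((1 - eps z / M) ^+ J)%:C * f z.
have br J : besicovitch P (r J).
  elim: J => [|J IHJ].
    by rewrite /r; under eq_fun do rewrite expr0 mul1r.
  have b2 := besicovitchZ (- (M^-1)%:C) (besicovitchM epsM beps IHJ).
  have := besicovitchD IHJ b2; congr besicovitch; apply/funext => z.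
  rewrite /r exprS; set p := _ ^+ J.
  by apply: complex_eqP; rewrite !ReImE /=; field; rewrite gt_eqF.
(* The closed form of the partial sum contains 1/epsilon, but membership follows from S (J+1) = S J
   + M^-1 r J, which only multiplies by epsilon. *)
pose S J z := ((eps z)^-1 * (1 - (1 - eps z / M) ^+ J))%:C * f z.
have bS J : besicovitch P (S J).
  elim: J => [|J IHJ].
    have := besicovitchZ 0 bf; congr besicovitch; apply/funext => z.
    by rewrite /S expr0 subrr mulr0.
  have := besicovitchD IHJ (besicovitchZ (M^-1)%:C (br J)); congr besicovitch.
  apply/funext => z; rewrite /S /r exprS; set p := _ ^+ J.
  by apply: complex_eqP; rewrite !ReImE /=; field; rewrite !gt_eqF.
have minv : cmeasurable (fun z => ((eps z)^-1)%:C).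
  apply: cmeasurable_real.
  (* Positivity of epsilon allows the inverse to be read as the measurable power of exponent -1. *)
  under eq_fun => z do rewrite -(powR_inv1 (ltW (eps0 z))).
  apply: (@measurableT_comp _ _ _ _ _ _ (@powR R ^~ (-1))).
    exact: measurable_powR.
  exact: beps.1.1.
apply: besicovitch_closed.
  by apply: cmeasurableM => //; exact: bf.1.
move=> e e0; have [K0 hK0] := besicovitch_mean_sq_le bf.
pose K := `|K0| + 1.
have hK : mean_sq_le K f.
  by apply: mean_sq_le_weak hK0; rewrite /K; have := ler_norm K0; lra.
(* 0 <= 1 - eps/M <= rho < 1, so the remainder factor eps^-1 (1 - eps/M)^J is at most a^-1 rho^J
   uniformly in z; squaring makes rho^2 the ratio of the geometric sequence. *)
pose rho := 1 - a / M.
have rho0 : 0 <= rho by rewrite subr_ge0 ler_pdivrMr// mul1r.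
have rho1 : rho < 1 by rewrite ltrBlDr ltrDl divr_gt0.
have r21 : `|rho ^+ 2| < 1 by rewrite normrX ger0_norm// exprn_ilt1.
have [J hJ] : exists J : nat, (a^-1 * rho ^+ J) ^+ 2 * K <= e.
  have /cvgrPdist_le /(_ _ e0) c := cvg_geometric (a ^- 2 * K) r21.
  near \oo%classic => J; exists J.
  have : `|0 - geometric (a ^- 2 * K) (rho ^+ 2) J| <= e by near: J.
  rewrite sub0r normrN /geometric/= => /(le_trans (ler_norm _)); apply: le_trans.
  by rewrite -exprM mulnC exprM exprMn exprVn mulrAC.
exists (S J); split; first exact: bS.
have msq : mean_sq_le e (fun z => (((eps z)^-1 * (1 - eps z / M) ^+ J)%:C) * f z).
  apply: mean_sq_le_weak hJ _; apply: mean_sq_leM hK.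
    have := (cmeasurable_real (n := 3)) _; apply.
    apply: measurable_funM; first exact: minv.1.
    apply: measurable_funX; apply: measurable_funB => //.
    by apply: measurable_funM => //; exact: beps.1.1.
  move=> z; have /andP[h1 h2] := heps z.
  have x0 : 0 <= 1 - eps z / M by rewrite subr_ge0 ler_pdivrMr// mul1r.
  have e0' := ltW (eps0 z); have a0' := ltW a0.
  rewrite sqmod_real; apply: lerXn2r.
  - by rewrite nnegrE mulr_ge0 ?invr_ge0 ?exprn_ge0.
  - by rewrite nnegrE mulr_ge0 ?invr_ge0 ?exprn_ge0.
  apply: ler_pM; [by rewrite invr_ge0|by rewrite exprn_ge0|by rewrite lef_pV2 ?posrE|].
  apply: lerXn2r; [by rewrite nnegrE|by rewrite nnegrE|].
  by rewrite /rho lerD2l lerN2 ler_pM2r ?invr_gt0.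
move: msq; congr mean_sq_le; apply/funext => z; rewrite /S; set p := _ ^+ J.
by apply: complex_eqP; rewrite !ReImE /=; field; rewrite gt_eqF.
Unshelve. all: by end_near. Qed.

Lemma integral_sqmodD_le m (D : set (m.-tuple R)) (f1 f2 : m.-tuple R -> C) :
  measurable D -> cmeasurable f1 -> cmeasurable f2 ->
  (\int[lebesgue_tuple R m]_(y in D) (sqmod (f1 y + f2 y))%:E <=
   2%:E * \int[lebesgue_tuple R m]_(y in D) (sqmod (f1 y))%:E +
   2%:E * \int[lebesgue_tuple R m]_(y in D) (sqmod (f2 y))%:E)%E.
Proof.
move=> mD m1 m2.
have ms (h : m.-tuple R -> C) : cmeasurable h -> measurable_fun D (fun y => (sqmod (h y))%:E).
  by move=> mh; apply/measurable_EFinP; apply: measurable_funTS; exact: measurable_sqmod.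
have m2s (h : m.-tuple R -> C) : cmeasurable h ->
    measurable_fun D (fun y => (2%:E * (sqmod (h y))%:E)%E).
  move=> mh; apply/measurable_EFinP; apply: measurable_funM => //.
  by apply: measurable_funTS; exact: measurable_sqmod.
have s0 (h : m.-tuple R -> C) y : (0 <= (sqmod (h y))%:E)%E by rewrite lee_fin sqmod_ge0.
rewrite -!ge0_integralZl_EFin//; try exact: ms.
rewrite -ge0_integralD//; try exact: m2s.
- apply: ge0_le_integral => //.
  + by move=> y _; exact: (s0 (fun y => f1 y + f2 y)).
  + by apply: (ms (fun y => f1 y + f2 y)); exact: cmeasurableD.
  + by apply: emeasurable_funD; exact: m2s.
  + by move=> y _; rewrite -!EFinM -EFinD lee_fin sqmodD_le.
- by move=> y _; rewrite mule_ge0.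
- by move=> y _; rewrite mule_ge0.
Qed.

(** [is_curl] asks for a parent and not only for the Besicovitch class, so a difference of two curls
    has to be given one. *)
Lemma is_parentB f g F G : is_parent P f F -> is_parent P g G ->
  is_parent P (fun z => f z - g z) (fun y => F y - G y).
Proof.
move=> [pF mF mf fE hF] [pG mG mg gE hG]; split.
- by move=> y j; rewrite pF pG.
- exact: cmeasurableB.
- exact: cmeasurableB.
- by move=> z; rewrite fE gE.
move=> e e0; have e4 : 0 < e / 4 by rewrite divr_gt0.
have [s1 [c1 [a1 b1]]] := hF _ e4; have [s2 [c2 [a2 b2]]] := hG _ e4.
have [s [c E']] := tpolyD s1 c1 s2 (fun k => - c2 k).
have TE y : tpoly s c y = tpoly s1 c1 y - tpoly s2 c2 y.
  by rewrite E' -mulN1r -tpolyZ; congr (_ + tpoly _ _ _); apply/funext => k; rewrite mulN1r.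
(* The dimension is left free: the estimate is applied once on the torus and once on the cubes of
   R^3. *)
have key m (D : set (m.-tuple R)) (f1 f2 T1 T2 : m.-tuple R -> C) (x : R) :
    measurable D -> cmeasurable f1 -> cmeasurable f2 -> cmeasurable T1 -> cmeasurable T2 ->
    (\int[lebesgue_tuple R m]_(y in D) (sqmod (f1 y - T1 y))%:E <= (x / 4)%:E)%E ->
    (\int[lebesgue_tuple R m]_(y in D) (sqmod (f2 y - T2 y))%:E <= (x / 4)%:E)%E ->
    (\int[lebesgue_tuple R m]_(y in D)
      (sqmod (f1 y - f2 y - (T1 y - T2 y)))%:E <= x%:E)%E.
  move=> mD mf1 mf2 mT1 mT2 h1 h2.
  have mN := cmeasurableN (cmeasurableB mf2 mT2).
  have := integral_sqmodD_le mD (cmeasurableB mf1 mT1) mN.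
  have DE y : f1 y - T1 y - (f2 y - T2 y) = f1 y - f2 y - (T1 y - T2 y) by ring.
  under eq_integral do rewrite DE.
  under [X in (_ <= _ + _ * X)%E -> _]eq_integral do rewrite sqmodN.
  move/le_trans; apply; apply: (@le_trans _ _ (2%:E * (x / 4)%:E + 2%:E * (x / 4)%:E)%E).
    by apply: leeD; rewrite lee_pmul2l.
  by rewrite -!EFinM -EFinD lee_fin; lra.
exists s, c; split.
  under eq_integral do rewrite TE.
  apply: key a1 a2 => //; first exact: measurable_torus_cube.
    exact: cmeasurable_tpoly.
  exact: cmeasurable_tpoly.
near=> L.
under eq_integral do rewrite TE.
apply: (@key 3) => //.
- exact: measurable_cube.
- exact: cmeasurable_tpoly_projT.
- exact: cmeasurable_tpoly_projT.
- by rewrite mulrAC; near: L.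
- by rewrite mulrAC; near: L.
Unshelve. all: by end_near. Qed.

Lemma periodic_expi (k : 'cV[int]_n) : periodic2pi (expi (ivec R k)).
Proof.
move=> y j; rewrite /expi.
have -> : \sum_i ivec R k i 0 * tnth [tuple tnth y i + (if i == j then 2 * pi else 0) | i < n] i
    = \sum_i ivec R k i 0 * tnth y i + (k j 0)%:~R * (2 * pi).
  under eq_bigr do rewrite tnth_mktuple mulrDr.
  rewrite big_split; congr (_ + _); rewrite (bigD1 j)//= eqxx !mxE big1 ?addr0//.
  by move=> i /negbTE ->; rewrite mulr0.
set x := \sum_i _.
have key (m : nat) (a : R) : cexp (a + m%:R * (2 * pi)) = cexp a.
  have -> : m%:R * (2 * pi) = (pi *+ 2) *+ m :> R.
    by rewrite [LHS]mulr_natl [X in X *+ _]mulr_natl.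
  by rewrite /cexp (periodicn (@cosD2pi R)) (periodicn (@sinD2pi R)).
case: (k j 0) => m; first exact: key.
(* A negative multiple is treated by reading [key] backwards from the shifted point. *)
by rewrite NegzE mulrNz mulNr -[in RHS](subrK (m.+1%:~R * (2 * pi)) x) key.
Qed.

Lemma is_parent_tpoly (s : seq 'cV[int]_n) (c : 'cV[int]_n -> C) :
  is_parent P (fun z => tpoly s c (projT P z)) (tpoly s c).
Proof.
split => //.
- by move=> y j; apply: eq_bigr => k _; rewrite periodic_expi.
- exact: cmeasurable_tpoly.
- exact: cmeasurable_tpoly_projT.
move=> e e0; exists s, c; split.
  by rewrite integral0_eq ?lee_fin ?(ltW e0)// => y _; rewrite subrr sqmod0.
apply: near_pinfty_gt0 => L L0; rewrite integral0_eq ?lee_fin.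
  by rewrite mulr_ge0 ?(ltW e0) ?exprn_ge0 ?mulr_ge0 ?(ltW L0).
by move=> y _; rewrite subrr sqmod0.
Qed.

Lemma L2qpB f g : L2qp P f -> L2qp P g -> L2qp P (fun z => f z - g z).
Proof. by move=> [F pF] [G pG]; exists (fun y => F y - G y); exact: is_parentB. Qed.

Lemma L2qp_tpoly (s : seq 'cV[int]_n) (c : 'cV[int]_n -> C) :
  L2qp P (fun z => tpoly s c (projT P z)).
Proof. by exists (tpoly s c); exact: is_parent_tpoly. Qed.

End parents.

(** * Vector fields and the Galerkin estimate *)

Definition in_box n (N : nat) (k : 'cV[int]_n) : bool := [forall j, `|k j 0| <= N%:Z].

Lemma box_enum n (N : nat) : exists s : seq 'cV[int]_n, uniq s /\ forall k, (k \in s) = in_box N k.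
Proof.
(* Each coordinate ranges over the 2N + 1 integers of [-N, N], encoded with an offset N. *)
pose F (f : {ffun 'I_n -> 'I_(N + N).+1}) : 'cV[int]_n :=
  \col_j ((f j : nat)%:Z - N%:Z).
exists (undup [seq F f | f : {ffun 'I_n -> 'I_(N + N).+1}]).
split=> [|k]; first exact: undup_uniq.
rewrite /in_box mem_undup; apply/fintype.imageP/forallP => [[f _ ->] j|h].
  rewrite mxE ler_norml; have := ltn_ord (f j).
  by move: (nat_of_ord (f j)) => m hm; apply/andP; split; lia.
exists [ffun j => inord `|(k j 0%R + N%:Z)%R|%N] => //; apply/colP => j.
rewrite mxE ffunE; have := h j; rewrite ler_norml => /andP[h1 h2].
have x0 : 0 <= k j 0 + N%:Z by rewrite -lerBlDr sub0r.
rewrite inordK ?gez0_abs ?addrK//.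
by rewrite ltnS -lez_nat gez0_abs// PoszD lerD2r.
Qed.

Section fields.
Context {R : realType} {n : nat} (P : 'M[R]_(3, n)).
Local Notation C := R[i].
Local Notation E := (3.-tuple R).
Local Notation field := (E -> 'cV[C]_3).
Implicit Types (u v w : field) (k : 'cV[int]_n).

(** The square of [qp_normv] on the Besicovitch class ([sqr_qp_normv]), split by components so that
    the scalar Bessel and Parseval bounds apply. *)
Definition sqnorm u : R := \sum_j complex.Re (qp_ip (component u j) (component u j)).

Definition besicovitchv u := forall j, besicovitch P (component u j).

Lemma besicovitchv_L2qpv u : L2qpv P u -> besicovitchv u.
Proof. by move=> hu j; exact: besicovitch_L2qp. Qed.

Lemma componentB u v j : component (fun z => u z - v z) j =
  fun z => component u j z - component v j z.
Proof. by apply/funext => z; rewrite /component !mxE. Qed.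

Lemma besicovitchvB u v : besicovitchv u -> besicovitchv v ->
  besicovitchv (fun z => u z - v z).
Proof. by move=> bu bv j; rewrite componentB; exact: besicovitchB. Qed.

Lemma L2qpvB u v : L2qpv P u -> L2qpv P v -> L2qpv P (fun z => u z - v z).
Proof. by move=> bu bv j; rewrite componentB; exact: L2qpB. Qed.

Lemma has_mean_ipv u v : besicovitchv u -> besicovitchv v ->
  has_mean (fun z => \sum_j u z j 0 * conjc (v z j 0)) (qp_ipv u v).
Proof.
move=> bu bv.
have m := @has_mean_sum R _ (index_enum 'I_3) _ _ (fun j => has_mean_ip (bu j) (bv j)).
by rewrite [qp_ipv u v](has_mean_mean m).
Qed.

Lemma has_rmean_sqnorm u : besicovitchv u ->
  has_rmean (fun z => \sum_j sqmod (u z j 0)) (sqnorm u).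
Proof.
move=> bu.
have m := @has_mean_sum R _ (index_enum 'I_3) _ _ (fun j => has_mean_ip (bu j) (bu j)).
move: (has_mean_Re m); rewrite Re_sum; congr has_rmean; apply/funext => z.
by rewrite Re_sum; apply: eq_bigr => j _; rewrite -sqmodE.
Qed.

Lemma sqnorm_ge0 u : besicovitchv u -> 0 <= sqnorm u.
Proof.
move=> bu; apply: has_rmean_le (@has_mean0 R).1 (has_rmean_sqnorm bu) _ => z.
by apply: sumr_ge0 => j _; exact: sqmod_ge0.
Qed.

Lemma sqr_qp_normv u : besicovitchv u -> qp_normv u ^+ 2 = sqnorm u.
Proof.
move=> bu; have : complex.Re (qp_ipv u u) = sqnorm u.
  apply: has_rmean_unique (has_mean_Re (has_mean_ipv bu bu)) _.
  move: (has_rmean_sqnorm bu); congr has_rmean; apply/funext => z.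
  by rewrite Re_sum; apply: eq_bigr => j _; rewrite -sqmodE.
by rewrite /qp_normv => ->; rewrite sqr_sqrtr// sqnorm_ge0.
Qed.

Lemma qp_coefvB u v k : besicovitchv u -> besicovitchv v ->
  qp_coefv (fun z => u z - v z) (freq P k) =
  qp_coefv u (freq P k) - qp_coefv v (freq P k).
Proof.
by move=> bu bv; apply/colP => j; rewrite !mxE componentB qp_coefB.
Qed.

(** Parseval bounds the left side by finite sums of squared coefficients, and Bessel bounds these by
    the right side. This absorbs the arbitrary choice made by [curl]. *)
Lemma sqnorm_le u v : Qindep P -> besicovitchv u -> besicovitchv v ->
  (forall k, qp_coefv u (freq P k) = qp_coefv v (freq P k)) ->
  sqnorm u <= sqnorm v.
Proof.
move=> iP bu bv uv; apply: ler_sum => j _; apply: (parseval_le iP) => // s us.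
apply: le_trans (bessel iP us (bv j)); rewrite le_eqVlt; apply/orP; left; apply/eqP.
apply: eq_bigr => k _; congr sqmod.
by have /colP/(_ j) := uv k; rewrite !mxE.
Qed.

Lemma crossB (a b c : 'cV[C]_3) : cross a (b - c) = cross a b - cross a c.
Proof. by apply/colP => j; rewrite !mxE; ring. Qed.

Lemma crossD (a b c : 'cV[C]_3) : cross a (b + c) = cross a b + cross a c.
Proof. by apply/colP => j; rewrite !mxE; ring. Qed.

Lemma cross0 (a : 'cV[C]_3) : cross a 0 = 0.
Proof. by apply/colP => j; rewrite !mxE !mulr0 subrr. Qed.

Lemma curlP u : (exists w, is_curl P u w) -> is_curl P u (curl P u).
Proof. by move=> [w hw]; apply: (@xgetPex _ _ (is_curl P u)); exists w. Qed.

Lemma is_curlB u v w1 w2 : besicovitchv u -> besicovitchv v ->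
  is_curl P u w1 -> is_curl P v w2 ->
  is_curl P (fun z => u z - v z) (fun z => w1 z - w2 z).
Proof.
move=> bu bv [lw1 c1] [lw2 c2]; split; first exact: L2qpvB.
move=> k; rewrite !qp_coefvB//; try exact: besicovitchv_L2qpv.
by rewrite c1 c2 crossB scalerBr.
Qed.

(** Has the shape of the span in [VNdiv0], so that a discrete field is a [tpolyv] by conversion. *)
Definition tpolyv (s : seq 'cV[int]_n) (c : 'cV[int]_n -> 'cV[C]_3) : field :=
  fun z => \sum_(k <- s) expi (freq P k) z *: c k.

Lemma component_tpolyv s c j : component (tpolyv s c) j =
  fun z => tpoly s (fun k => c k j 0) (projT P z).
Proof.
apply/funext => z; rewrite tpoly_projT /component /tpolyv summxE.
by apply: eq_bigr => k _; rewrite mxE mulrC.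
Qed.

Lemma L2qpv_tpolyv s c : L2qpv P (tpolyv s c).
Proof. by move=> j; rewrite component_tpolyv; exact: L2qp_tpoly. Qed.

Lemma qp_coefv_tpolyv s c k : Qindep P ->
  qp_coefv (tpolyv s c) (freq P k) = \sum_(l <- s | l == k) c l.
Proof.
move=> iP; apply/colP => j; rewrite !mxE component_tpolyv qp_coef_tpoly// summxE.
by [].
Qed.

(** Such a witness guarantees that [curl] of a discrete field is a true curl and not the default 0
    of [xget]. *)
Lemma is_curl_tpolyv s c : Qindep P -> exists w, is_curl P (tpolyv s c) w.
Proof.
move=> iP.
exists (tpolyv s (fun k => 'i *: cross (map_mx (real_complex R) (freq P k)) (c k))).
split=> [|k]; first exact: L2qpv_tpolyv.
rewrite !qp_coefv_tpolyv//.
elim: s => [|l s IHs]; first by rewrite !big_nil cross0 scaler0.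
rewrite !big_cons; case: eqP => [->|//].
by rewrite IHs crossD scalerDr.
Qed.

Lemma sum_le_per_sqseminorm m (F : n.-tuple R -> C) s : Hper m F -> uniq s ->
  \sum_(k <- s) (sqnormz R k ^+ m * sqmod (per_coef F k)) <= per_sqseminorm m F.
Proof.
move=> [_ _ _ hF] us.
have sq0 k : 0 <= sqnormz R k by apply: sumr_ge0 => j _; exact: sqr_ge0.
have t0 k : 0 <= sqnormz R k ^+ m * sqmod (per_coef F k).
  by rewrite mulr_ge0 ?exprn_ge0 ?sqmod_ge0.
(* The weight |k|^(2m) is at most (1 + |k|^2)^m, so [Hper] makes the sum finite and [fine]
   faithful. *)
rewrite -lee_fin /per_sqseminorm fineK; last first.
  rewrite ge0_fin_numE; last by apply: esum_ge0 => k _; rewrite lee_fin.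
  apply: le_lt_trans hF; apply: le_esum => k _; rewrite lee_fin.
  rewrite ler_wpM2r ?sqmod_ge0// lerXn2r ?nnegrE ?addr_ge0//.
  by rewrite lerDr.
apply: esum_ge; exists [set` s]; first by split => //; exact: finite_seq.
by rewrite -fsbig_seq// sumEFin.
Qed.

Lemma notin_box_sqnormz (N : nat) k : ~~ in_box N k -> N%:R ^+ 2 <= sqnormz R k.
Proof.
rewrite negb_forall => /existsP[j]; rewrite -ltNge => hj.
rewrite /sqnormz (bigD1 j)//=.
apply: (@le_trans _ _ ((k j 0)%:~R ^+ 2)); last first.
  by rewrite lerDl; apply: sumr_ge0 => i _; exact: sqr_ge0.
rewrite -[leRHS](real_normK (num_real _)) lerXn2r ?nnegrE ?ler0n//.
by rewrite -intr_norm -[N%:R]/(N%:Z%:~R) ler_int ltW.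
Qed.

(** A coefficient that survives has |k|^2 >= N^2, hence 1 <= N^(-2m) |k|^(2m). *)
Lemma tail_bound (f d : E -> C) (m N : nat) : Qindep P -> (0 < N)%N ->
  L2qp P f -> Hper m (parent P f) -> besicovitch P d ->
  (forall k, qp_coef d (freq P k) = if in_box N k then 0 else qp_coef f (freq P k)) ->
  complex.Re (qp_ip d d) <= (N%:R ^- m) ^+ 2 * per_sqseminorm m (parent P f).
Proof.
move=> iP N0 lf hf bd dE; apply: (parseval_le iP bd) => s us.
have Nm0 : 0 < (N%:R ^- m : R) ^+ 2 by rewrite exprn_gt0// invr_gt0 exprn_gt0// ltr0n.
apply: le_trans (ler_wpM2l (ltW Nm0) (sum_le_per_sqseminorm hf us)).
rewrite mulr_sumr; apply: ler_sum => k _.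
have sq0 : 0 <= sqnormz R k by apply: sumr_ge0 => j _; exact: sqr_ge0.
rewrite dE; case: ifPn => [_|kN].
  by rewrite sqmod0 !mulr_ge0 ?exprn_ge0 ?sqmod_ge0 ?invr_ge0 ?ler0n.
rewrite (per_coef_parent k iP (parentP lf)) mulrA ler_peMl ?sqmod_ge0//.
rewrite exprVn mulrC ler_pdivlMr ?exprn_gt0 ?ltr0n// mul1r.
rewrite -exprM mulnC exprM lerXn2r ?nnegrE ?exprn_ge0 ?ler0n//.
exact: notin_box_sqnormz.
Qed.

End fields.

(** * Céa's inequality at a single point *)

Section cea.
Context {R : realType}.
Implicit Types x y : R[i].

(** Here x stands for the error and y for the test field. From a |x|^2 <= t |x|^2 = t Re (x conj y)
    + t Re (x conj (x - y)), Young's inequality absorbs a/2 |x|^2 out of the last term. *)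
Lemma cea_pointwise (t a M : R) x y : 0 < a -> a <= t <= M ->
  a / 2 * sqmod x <=
  t * complex.Re (x * conjc y) + M ^+ 2 / (2 * a) * sqmod (x - y).
Proof.
move=> a0 /andP[at_ tM].
rewrite /sqmod !ReImE.
set b := complex.Re x; set c := complex.Im x; set d := complex.Re y.
set e := complex.Im y.
have key (p q : R) : a / 2 * p ^+ 2 <= t * (p * q) + M ^+ 2 / (2 * a) * (p - q) ^+ 2.
  have h1 : 0 <= (2 * a)^-1 * (a * p - t * (p - q)) ^+ 2.
    by rewrite mulr_ge0 ?sqr_ge0// invr_ge0 mulr_ge0// ltW.
  have E1 : (2 * a)^-1 * (a * p - t * (p - q)) ^+ 2 =
      a / 2 * p ^+ 2 - t * p * (p - q) + t ^+ 2 / (2 * a) * (p - q) ^+ 2.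
    by field; rewrite gt_eqF.
  have h2 : t ^+ 2 / (2 * a) * (p - q) ^+ 2 <= M ^+ 2 / (2 * a) * (p - q) ^+ 2.
    rewrite ler_wpM2r ?sqr_ge0// ler_pM2r ?invr_gt0 ?mulr_gt0//.
    by rewrite lerXn2r ?nnegrE//; lra.
  have h3 : a * p ^+ 2 <= t * p ^+ 2 by rewrite ler_wpM2r ?sqr_ge0.
  by nra.
have := lerD (key b d) (key c e); lra.
Qed.

(** A^2 + B^2 <= (A + B)^2 for nonnegative A and B. *)
Lemma sqrt_le_mulD (x K q A B : R) : 0 <= K -> 0 <= q -> 0 <= A -> 0 <= B ->
  x <= K ^+ 2 * (q ^+ 2 * A ^+ 2 + q ^+ 2 * B ^+ 2) ->
  Num.sqrt x <= K * q * (A + B).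
Proof.
move=> K0 q0 A0 B0 hx.
have KqAB0 : 0 <= K * q * (A + B) by rewrite mulr_ge0 ?mulr_ge0 ?addr_ge0.
rewrite -[leRHS](ger0_norm KqAB0) -sqrtr_sqr; apply: ler_wsqrtr.
apply: le_trans hx _; rewrite -subr_ge0.
rewrite (_ : _ - _ = 2 * (K * q) ^+ 2 * (A * B)); last by ring.
by rewrite mulr_ge0 ?mulr_ge0 ?sqr_ge0.
Qed.

(** [t] is the value of 1/epsilon at the point. The mixed term is written as a difference of two
    energy integrands, whose mean orthogonality will make zero. *)
Lemma cea_sum (t kappa a M : R) (u uN v w wN wv : 'I_3 -> R[i]) : 0 < a ->
  a <= t <= M -> a <= kappa <= M ->
  a / 2 * (\sum_j sqmod (u j - uN j) + \sum_j sqmod (w j - wN j)) <=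
  complex.Re (\sum_j t%:C * w j * conjc (wv j) + kappa%:C * \sum_j u j * conjc (v j)
    - (\sum_j t%:C * wN j * conjc (wv j) + kappa%:C * \sum_j uN j * conjc (v j)))
  + M ^+ 2 / (2 * a) * (\sum_j sqmod (u j - uN j - v j)
    + \sum_j sqmod (w j - wN j - wv j)).
Proof.
move=> a0 ht hk.
have -> : complex.Re (\sum_j t%:C * w j * conjc (wv j) + kappa%:C * \sum_j u j * conjc (v j)
    - (\sum_j t%:C * wN j * conjc (wv j) + kappa%:C * \sum_j uN j * conjc (v j))) =
    \sum_j (kappa * complex.Re ((u j - uN j) * conjc (v j)) +
      t * complex.Re ((w j - wN j) * conjc (wv j))).
  rewrite mulr_sumr -big_split mulr_sumr -big_split -sumrB Re_sum.
  by apply: eq_bigr => j _; rewrite !ReImE /=; ring.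
rewrite -big_split -big_split mulr_sumr mulr_sumr -big_split; apply: ler_sum => j _.
have p1 := cea_pointwise (u j - uN j) (v j) a0 hk.
have p2 := cea_pointwise (w j - wN j) (wv j) a0 ht.
apply: le_trans (_ : _ <= a / 2 * sqmod (u j - uN j) + a / 2 * sqmod (w j - wN j)) _.
  by rewrite mulrDr.
apply: le_trans (lerD p1 p2) _.
by rewrite /= [X in _ <= _ + X]mulrDr addrACA.
Qed.

End cea.

(** * Discrete test fields, truncation and quasi-optimality *)

Section galerkin.
Context {R : realType} {n : nat} (P : 'M[R]_(3, n)).
Local Notation C := R[i].
Local Notation E := (3.-tuple R).
Local Notation field := (E -> 'cV[C]_3).
Implicit Types (u v w : field) (k : 'cV[int]_n).

(** Conformity: discrete fields may be used as test fields in the continuous problem. *)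
Lemma VNdiv0_Vdiv0 N v : Qindep P -> VNdiv0 P N v -> Vdiv0 P v.
Proof.
move=> iP [[s [c [_ ->]]] hdiv]; split => //; split.
  exact: (L2qpv_tpolyv P s c).
exact: (is_curl_tpolyv s c iP).
Qed.

Lemma qp_coefv_VNdiv0 N v k : Qindep P -> VNdiv0 P N v -> ~~ in_box N k ->
  qp_coefv v (freq P k) = 0.
Proof.
move=> iP [[s [c [hs ->]]] _] kN.
rewrite (@qp_coefv_tpolyv R n P s c)// big1_seq// => l /andP[/eqP -> ls].
by case/negP: kN; apply/forallP; exact: hs.
Qed.

Lemma div_freeE u : div_free P u <->
  forall k, 'i * \sum_j (freq P k j 0)%:C * qp_coefv u (freq P k) j 0 = 0.
Proof.
split=> h k; have := h k; congr (_ * _ = _); apply: eq_bigr => j _;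
  congr (_ * _); by rewrite mxE.
Qed.

Lemma div_freeB u v : besicovitchv P u -> besicovitchv P v ->
  div_free P u -> div_free P v -> div_free P (fun z => u z - v z).
Proof.
move=> bu bv du dv; apply/div_freeE => k; rewrite qp_coefvB//.
have /div_freeE/(_ k) {}du := du; have /div_freeE/(_ k) {}dv := dv.
under eq_bigr do rewrite [X in _ * X]mxE [X in _ + X]mxE mulrBr.
by rewrite sumrB mulrBr du dv subr0.
Qed.

Definition truncation (s : seq 'cV[int]_n) u : field :=
  tpolyv P s (fun k => qp_coefv u (freq P k)).

Lemma qp_coefv_truncation s u k : Qindep P -> uniq s ->
  qp_coefv (truncation s u) (freq P k) =
  if k \in s then qp_coefv u (freq P k) else 0.
Proof.
move=> iP us; rewrite qp_coefv_tpolyv//; case: ifPn => ks.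
  by rewrite -big_filter filter_pred1_uniq// big_seq1.
by rewrite big1_seq// => l /andP[/eqP -> ls]; rewrite ls in ks.
Qed.

(** Vanishing divergence is a condition on each coefficient separately, so truncation preserves
    it. *)
Lemma truncation_VNdiv0 N s u : Qindep P -> uniq s ->
  (forall k, (k \in s) = in_box N k) -> div_free P u ->
  VNdiv0 P N (truncation s u).
Proof.
move=> iP us hs du; split.
  exists s, (fun k => qp_coefv u (freq P k)); split => // k.
  by rewrite hs => /forallP.
apply/div_freeE => k; rewrite qp_coefv_truncation//.
case: ifP => _; first by have /div_freeE := du.
by rewrite big1 ?mulr0// => j _; rewrite [X in _ * X]mxE mulr0.
Qed.

Lemma exists_truncation N u : Qindep P -> div_free P u -> exists v,
  VNdiv0 P N v /\ forall k, qp_coefv v (freq P k) =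
    if in_box N k then qp_coefv u (freq P k) else 0.
Proof.
move=> iP du; have [s [us hs]] := box_enum n N.
exists (truncation s u); split; first exact: truncation_VNdiv0.
by move=> k; rewrite qp_coefv_truncation// hs.
Qed.

Lemma has_mean_weak (eps : E -> R) (kappa a M : R) u w v1 v2 : 0 < a ->
  (forall z, a <= eps z <= M) -> L2qp P (fun z => (eps z)%:C) ->
  besicovitchv P u -> besicovitchv P w -> besicovitchv P v1 -> besicovitchv P v2 ->
  has_mean (fun z => \sum_j (((eps z)^-1)%:C *: w z) j 0 * conjc (v2 z j 0) +
      kappa%:C * \sum_j u z j 0 * conjc (v1 z j 0))
    (qp_ipv (fun z => ((eps z)^-1)%:C *: w z) v2 + kappa%:C * qp_ipv u v1).
Proof.
move=> a0 heps leps bu bw bv1 bv2.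
have bew : besicovitchv P (fun z => ((eps z)^-1)%:C *: w z).
  move=> j; have := besicovitch_inv a0 heps (besicovitch_L2qp leps) (bw j).
  by congr besicovitch; apply/funext => z; rewrite /component mxE.
apply: has_meanD; first exact: (has_mean_ipv bew).
by apply: has_meanZ; exact: has_mean_ipv bu bv1.
Qed.

(** The average of [cea_sum] over z. The curls are free variables tied only by [orth], so any choice
    of representatives is allowed. *)
Lemma galerkin_best_approx (eps : E -> R) (kappa a b : R)
    (c0 c1 : R) (u uN v w wN wv e we : field) : 0 < a ->
  0 < c0 -> c0 <= kappa <= c1 -> c0 <= b^-1 -> a^-1 <= c1 ->
  (forall z, a <= eps z <= b) -> L2qp P (fun z => (eps z)%:C) ->
  besicovitchv P u -> besicovitchv P uN -> besicovitchv P v ->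
  besicovitchv P w -> besicovitchv P wN -> besicovitchv P wv ->
  qp_ipv (fun z => ((eps z)^-1)%:C *: w z) wv + kappa%:C * qp_ipv u v =
  qp_ipv (fun z => ((eps z)^-1)%:C *: wN z) wv + kappa%:C * qp_ipv uN v ->
  e = (fun z => u z - uN z) -> we = (fun z => w z - wN z) ->
  sqnorm e + sqnorm we <= (c1 / c0) ^+ 2 *
    (sqnorm (fun z => e z - v z) + sqnorm (fun z => we z - wv z)).
Proof.
move=> a0 c00 hk c0b ac1 heps leps bu bN bv bw bwN bwv orth -> ->; cbv beta.
have be := besicovitchvB bu bN; have bwe := besicovitchvB bw bwN.
have b0 : 0 < b.
  have /andP[h1 h2] := heps [tuple of nseq 3 0].
  exact: lt_le_trans a0 (le_trans h1 h2).
have m1 := has_mean_weak kappa a0 heps leps bu bw bv bwv.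
have m2 := has_mean_weak kappa a0 heps leps bN bwN bv bwv.
rewrite orth in m1.
(* Orthogonality: the mixed term has mean zero. *)
have m0 := has_mean_Re (has_meanB m1 m2); rewrite subrr in m0.
have m3 := has_rmeanZ (c1 ^+ 2 / (2 * c0)) (has_rmeanD
  (has_rmean_sqnorm (besicovitchvB be bv)) (has_rmean_sqnorm (besicovitchvB bwe bwv))).
have m4 := has_rmeanZ (c0 / 2) (has_rmeanD (has_rmean_sqnorm be) (has_rmean_sqnorm bwe)).
have H := has_rmean_le m4 (has_rmeanD m0 m3) _.
have {}H : c0 / 2 * (sqnorm (fun z => u z - uN z) + sqnorm (fun z => w z - wN z)) <=
    c1 ^+ 2 / (2 * c0) * (sqnorm (fun z => u z - uN z - v z) +
      sqnorm (fun z => w z - wN z - wv z)).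
  apply: le_trans (H _) _ => [z|]; last by rewrite add0r.
  have /andP[h1 h2] := heps z; have eps0 := lt_le_trans a0 h1.
  have ht : c0 <= (eps z)^-1 <= c1.
    by rewrite (le_trans c0b) ?(le_trans _ ac1)// lef_pV2 ?posrE.
  have := cea_sum (fun j => u z j 0) (fun j => uN z j 0) (fun j => v z j 0)
    (fun j => w z j 0) (fun j => wN z j 0) (fun j => wv z j 0) c00 ht hk.
  congr (_ * (_ + _) <= complex.Re (_ + _ - (_ + _)) + _ * (_ + _));
    by apply: eq_bigr => j _; rewrite !mxE.
(* The factor 2/c0 clears the left side and turns c1^2 / (2 c0) into (c1/c0)^2. *)
have K0 : 0 <= 2 / c0 by rewrite divr_ge0// ltW.
have := ler_wpM2l K0 H.
rewrite [leLHS]mulrA (_ : 2 / c0 * (c0 / 2) = 1); last by field; rewrite gt_eqF.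
rewrite mul1r [leRHS]mulrA.
by rewrite (_ : 2 / c0 * (c1 ^+ 2 / (2 * c0)) = (c1 / c0) ^+ 2)//; field; rewrite gt_eqF.
Qed.

Lemma sqnorm_tail_bound (N m : nat) u d : Qindep P -> (0 < N)%N ->
  L2qpv P u -> (forall j, Hper m (parentv P u j)) -> besicovitchv P d ->
  (forall k, qp_coefv d (freq P k) =
     if in_box N k then 0 else qp_coefv u (freq P k)) ->
  sqnorm d <= (N%:R ^- m) ^+ 2 * per_seminormv m (parentv P u) ^+ 2.
Proof.
move=> iP N0 lu hu bd dE; rewrite /per_seminormv sqr_sqrtr; last first.
  apply: sumr_ge0 => j _; rewrite fine_ge0//; apply: esum_ge0 => k _.
  by rewrite lee_fin mulr_ge0 ?sqmod_ge0// exprn_ge0//; apply: sumr_ge0 => i _; exact: sqr_ge0.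
rewrite mulr_sumr; apply: ler_sum => j _.
apply: (tail_bound iP N0 (lu j) (hu j) (bd j)) => k.
by have /colP/(_ j) := dE k; rewrite mxE; case: ifP => _; rewrite mxE.
Qed.

End galerkin.

Theorem theorem3 (R : realType) (kappa epsA epsB : R)
    (kappa_gt0 : 0 < kappa) (epsA_gt0 : 0 < epsA) :
  exists C : R, 0 < C /\
  forall (n : nat) (P : 'M[R]_(3, n)) (eps : 3.-tuple R -> R)
    (g u uN : 3.-tuple R -> 'cV[R[i]]_3) (N m : nat),
    Qindep P ->
    L2qp P (fun z => (eps z)%:C) ->
    (forall z, epsA <= eps z <= epsB) ->
    L2qpv P g -> div_free P g ->
    (0 < N)%N -> (0 < m)%N ->
    weak_solution P eps kappa g (Vdiv0 P) u ->
    weak_solution P eps kappa g (VNdiv0 P N) uN ->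
    (forall j, Hper m (parentv P u j)) ->
    (forall j, Hper m (parentv P (curl P u) j)) ->
    qp_curl_norm P (fun z => u z - uN z) <=
    C * (N%:R ^+ m)^-1 *
      (per_seminormv m (parentv P u) + per_seminormv m (parentv P (curl P u))).
Proof.
(* [epsB] may be nonpositive, in which case no [eps] qualifies. *)
pose b := Num.max epsA epsB.
have b0 : 0 < b by rewrite lt_max epsA_gt0.
(* The coercivity and continuity constants of the energy form, both weights of which lie in
   [c0, c1]. *)
pose c0 := Num.min kappa b^-1; pose c1 := Num.max kappa epsA^-1.
have c00 : 0 < c0 by rewrite lt_min kappa_gt0 invr_gt0.
have c10 : 0 < c1 by rewrite lt_max kappa_gt0.
exists (c1 / c0); split; first exact: divr_gt0.
have hk : c0 <= kappa <= c1 by rewrite ge_min lexx le_max lexx.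
have c0b : c0 <= b^-1 by rewrite ge_min lexx orbT.
have ac1 : epsA^-1 <= c1 by rewrite le_max lexx orbT.
move=> n P eps g u uN N m iP leps heps _ _ N0 _ su sN hu hw.
have heps' z : epsA <= eps z <= b.
  by have /andP[h1 h2] := heps z; rewrite h1 le_max h2 orbT.
have [[lu cu] du] := su.1.
have VN := sN.1; have [[lN cN] dN] := VNdiv0_Vdiv0 iP VN.
have bu := besicovitchv_L2qpv lu; have bN := besicovitchv_L2qpv lN.
(* The existential makes [e] opaque, so that it unfolds only through [eE]; [w] and [wv] are treated
   alike. *)
have [e eE] : exists e : 3.-tuple R -> 'cV[R[i]]_3, e = fun z => u z - uN z.
  by eexists.
have [w wE] : exists w : 3.-tuple R -> 'cV[R[i]]_3,
    w = fun z => curl P u z - curl P uN z by eexists.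
rewrite -eE.
have be : besicovitchv P e by rewrite eE; exact: besicovitchvB.
have hew : is_curl P e w by rewrite eE wE; apply: is_curlB => //; exact: curlP.
have bw := besicovitchv_L2qpv hew.1.
have [_ hce] : is_curl P e (curl P e) by apply: curlP; exists w.
have bce : besicovitchv P (curl P e).
  by apply: besicovitchv_L2qpv; have [] : is_curl P e (curl P e) by apply: curlP; exists w.
have de : div_free P e by rewrite eE; exact: div_freeB.
have [v [Vv vE]] := exists_truncation N iP de.
have [[lv cv] _] := VNdiv0_Vdiv0 iP Vv.
have [_ hcv] := curlP cv.
have bv := besicovitchv_L2qpv lv; have bcv := besicovitchv_L2qpv (curlP cv).1.
have [wv wvE] : exists wv : 3.-tuple R -> 'cV[R[i]]_3, wv = curl P v by eexists.
(* Both forms, tested with v, equal the same right side (g, v). *)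
have orth := etrans (su.2 _ (VNdiv0_Vdiv0 iP Vv)) (esym (sN.2 _ Vv)).
rewrite -wvE in hcv bcv orth.
have cea := galerkin_best_approx epsA_gt0 c00 hk c0b ac1 heps' leps bu bN bv
  (besicovitchv_L2qpv (curlP cu).1) (besicovitchv_L2qpv (curlP cN).1) bcv orth eE wE.
have [_ hwe] := hew; have [_ hcu] := curlP cu.
have eN k : ~~ in_box N k -> qp_coefv e (freq P k) = qp_coefv u (freq P k).
  by move=> kN; rewrite eE (qp_coefvB k bu bN) (qp_coefv_VNdiv0 iP VN kN) subr0.
have E1 k : qp_coefv (fun z => e z - v z) (freq P k) =
    if in_box N k then 0 else qp_coefv u (freq P k).
  rewrite (qp_coefvB k be bv) vE; case: ifPn => kN; first by rewrite subrr.
  by rewrite subr0 eN.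
(* The curl acts on each coefficient separately: inside the box e and v have the same one, outside
   it v has none and e has that of u. *)
have E2 k : qp_coefv (fun z => w z - wv z) (freq P k) =
    if in_box N k then 0 else qp_coefv (curl P u) (freq P k).
  rewrite (qp_coefvB k bw bcv) (hwe k) (hcv k) vE; case: ifPn => kN; first by rewrite subrr.
  by rewrite cross0 scaler0 subr0 hcu eN.
have T1 := sqnorm_tail_bound iP N0 lu hu (besicovitchvB be bv) E1.
have T2 := sqnorm_tail_bound iP N0 (curlP cu).1 hw (besicovitchvB bw bcv) E2.
(* [curl P e] and [w] are two curls of [e]: they differ by a null function. *)
have cE : sqnorm (curl P e) <= sqnorm w.
  by apply: (sqnorm_le iP bce bw) => k; rewrite hce hwe.
rewrite /qp_curl_norm (sqr_qp_normv be) (sqr_qp_normv bce).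
set A := per_seminormv _ _; set B := per_seminormv _ _.
have A0 : 0 <= A by exact: sqrtr_ge0.
have B0 : 0 <= B by exact: sqrtr_ge0.
have Nm0 : 0 <= N%:R ^- m :> R by rewrite invr_ge0 exprn_ge0 ?ler0n.
have K0 : 0 <= c1 / c0 by rewrite divr_ge0 ?ltW.
apply: sqrt_le_mulD => //.
apply: le_trans (_ : _ <= sqnorm e + sqnorm w) _; first by rewrite lerD2l.
exact: le_trans cea (ler_wpM2l (sqr_ge0 _) (lerD T1 T2)).
Qed.
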